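(* Let $n\ge 0$, $d\ge 1$, and let $f\in\mathbb{R}[x_0,\dots,x_n]$ be a homogeneous polynomial of degree $d$ that is irreducible and hyperbolic with respect to $e\in\mathbb{R}^{n+1}$. Suppose $f=\det(M)$, where $M=x_0M_0+\cdots+x_nM_n$ and $M_0,\dots,M_n$ are Hermitian $d\times d$ matrices. Let $$\mathcal{C}(M)=\bigl\{\lambda^T M^{\mathrm{adj}}\,\overline{\lambda}\;:\;\lambda\in\mathbb{C}^d\setminus\{0\}\bigr\}.$$ Then the following are equivalent: (1) Some polynomial in $\mathcal{C}(M)$ interlaces $f$ with respect to $e$. (2) Every polynomial in $\mathcal{C}(M)$ interlaces $f$ with respect to $e$. (3) The matrix $M(e)=e_0M_0+\cdots+e_nM_n$ is (positive or negative) definite.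
   Context: A homogeneous polynomial $f\in\mathbb{R}[x_0,\dots,x_n]$ is hyperbolic with respect to $e\in\mathbb{R}^{n+1}$ if $f(e)\ne 0$ and for every $a\in\mathbb{R}^{n+1}$ all roots of the univariate polynomial $f(te+a)\in\mathbb{R}[t]$ are real. For univariate real polynomials $p,q$ of degrees $d$ and $d-1$ respectively, with only real zeros $\alpha_1\le\cdots\le\alpha_d$ of $p$ and $\beta_1\le\cdots\le\beta_{d-1}$ of $q$ (counted with multiplicity), $q$ interlaces $p$ if $\alpha_i\le\beta_i\le\alpha_{i+1}$ for $i=1,\dots,d-1$. If $f$ is hyperbolic with respect to $e$ and $g$ is a real homogeneous polynomial of degree $\deg(f)-1$, then $g$ interlaces $f$ with respect to $e$ if $g(te+a)$ interlaces $f(te+a)$ in $\mathbb{R}[t]$ for every $a\in\mathbb{R}^{n+1}$. $M^{\mathrm{adj}}$ denotes the adjugate matrix of $M$ (so $M\cdot M^{\mathrm{adj}}=\det(M)I$), and $\overline{\lambda}$ is the entrywise complex conjugate of $\lambda$. *)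

(* Defs.v *)
From HB Require Import structures.
From mathcomp Require Import all_boot all_order all_algebra.
From mathcomp Require Import reals.
From mathcomp Require Import complex.
From mathcomp Require Import mpoly.

Set Implicit Arguments.
Unset Strict Implicit.
Unset Printing Implicit Defensive.

Import Order.TTheory GRing.Theory Num.Theory.
Local Open Scope ring_scope.
Local Open Scope complex_scope.
Local Open Scope sesquilinear_scope.

Definition irreducible_mpoly (K : idomainType) (m : nat)
    (f : {mpoly K[m]}) : Prop :=
  [/\ f != 0, f \isn't a GRing.unit &
      forall g h : {mpoly K[m]}, f = g * h ->
        g \is a GRing.unit \/ h \is a GRing.unit].

(* The univariate polynomial f(te + a) in the variable t = 'X. *)
Definition line_poly (K : comNzRingType) (m : nat) (f : {mpoly K[m]})
    (e a : 'I_m -> K) : {poly K} :=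
  mmap polyC (fun i => (e i) *: 'X + (a i)%:P) f.

Definition hyperbolic (R : realType) (m : nat) (f : {mpoly R[m]})
    (e : 'I_m -> R) : Prop :=
  f.@[e] != 0 /\
  forall (a : 'I_m -> R) (z : R[i]),
    root (map_poly (real_complex R) (line_poly f e a)) z -> z \is Num.real.

(* s lists the zeros of p in increasing order with multiplicity, all of them
   being real; in particular size s is the degree of p. *)
Definition ordered_zeros (R : realType) (p : {poly R}) (s : seq R) : Prop :=
  [/\ p != 0, sorted <=%R s &
      p = lead_coef p *: \prod_(x <- s) ('X - x%:P)].

Definition interlaces (R : realType) (q p : {poly R}) : Prop :=
  exists alpha beta : seq R,
    [/\ ordered_zeros p alpha, ordered_zeros q beta,
        size alpha = (size beta).+1 &
        forall i : nat, (i < size beta)%N ->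
          alpha`_i <= beta`_i /\ beta`_i <= alpha`_i.+1].

(* msize f is deg f + 1, so (msize f).-2 is deg f - 1. *)
Definition interlaces_wrt (R : realType) (m : nat) (e : 'I_m -> R)
    (g f : {mpoly R[m]}) : Prop :=
  g \is (msize f).-2.-homog /\
  forall a : 'I_m -> R, interlaces (line_poly g e a) (line_poly f e a).

(* A polynomial given with complex coefficients interlaces f when it is
   actually a real polynomial and interlaces f as such. *)
Definition cx_interlaces_wrt (R : realType) (m : nat) (e : 'I_m -> R)
    (h : {mpoly R[i][m]}) (f : {mpoly R[m]}) : Prop :=
  exists g : {mpoly R[m]},
    map_mpoly (real_complex R) g = h /\ interlaces_wrt e g f.

Definition pencil (K : comNzRingType) (m d : nat) (M : 'I_m -> 'M[K]_d) :
    'M[{mpoly K[m]}]_d :=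
  \sum_i 'X_i *: map_mx (@mpolyC m K) (M i).

Definition pencil_at (R : realType) (m d : nat) (M : 'I_m -> 'M[R[i]]_d)
    (e : 'I_m -> R) : 'M[R[i]]_d :=
  \sum_i (e i)%:C *: M i.

Definition adj_form (R : realType) (m d : nat) (M : 'I_m -> 'M[R[i]]_d)
    (lam : 'cV[R[i]]_d) : {mpoly R[i][m]} :=
  ((map_mx (@mpolyC m R[i]) lam)^T *m \adj (pencil M)
     *m map_mx (@mpolyC m R[i]) (map_mx Num.conj lam)) ord0 ord0.

Definition adj_system (R : realType) (m d : nat) (M : 'I_m -> 'M[R[i]]_d)
    (h : {mpoly R[i][m]}) : Prop :=
  exists lam : 'cV[R[i]]_d, lam != 0 /\ h = adj_form M lam.

(* For z : R[i], 0 < z means that z is real and positive. *)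
Definition posdefmx (R : realType) (d : nat) (A : 'M[R[i]]_d) : Prop :=
  A \is hermsymmx /\
  forall v : 'cV[R[i]]_d, v != 0 -> 0 < (v ^t* *m A *m v) ord0 ord0.

Definition definitemx (R : realType) (d : nat) (A : 'M[R[i]]_d) : Prop :=
  posdefmx A \/ posdefmx (- A).

(* Main.v *)
Require Import Defs.
From HB Require Import structures.
From mathcomp Require Import all_boot all_order all_algebra.
From mathcomp Require Import separable.
From mathcomp Require Import boolp reals.
From mathcomp Require Import complex polyrcf.
From mathcomp Require Import mpoly.
From mathcomp Require Import ring.

Set Implicit Arguments.
Unset Strict Implicit.
Unset Printing Implicit Defensive.

Import Order.TTheory GRing.Theory Num.Theory.
Local Open Scope ring_scope.
Local Open Scope complex_scope.
Local Open Scope sesquilinear_scope.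

(** Along a line t |-> t e + a the pencil becomes N(t) = t E + A with E = M(e)
    and A = M(a) Hermitian, f becomes det N(t), and the member of C(M) given by
    lam becomes g_lam(t), the value of lam^T adj(N(t)) conj(lam).

    Suppose that E is definite. A congruence turns E into plus or minus the
    identity and A into a real diagonal matrix [simultaneous_diag]. Up to
    nonzero real constants f is then the product of the t - x_i, and g_lam is
    the sum over i of |u_i|^2 times the product of the t - x_j with j <> i,
    where u is a nonzero vector. Such a combination interlaces f
    [cone_interlaces]: zeros common to both are peeled off one at a time, and
    when none is left the x_i are distinct, the combination changes sign
    between consecutive x_i, and the intermediate value theorem finds all its
    zeros. So a definite E makes every member of C(M) an interlacer.

    Suppose conversely that g_lam interlaces f. At a zero z of f the matrix
    adj(N(z)) has rank at most one [mxrank_adj], whence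
    g_lam(z) g_mu(z) = |h(z)|^2 for the corresponding mixed value h, for every
    mu [hform_rank1]. On a line where f has simple zeros and no zero in common
    with g_lam, interlacing gives all the numbers g_lam(z) f'(z) one common
    sign [interlaces_sign]; hence the quotients g_mu(z) / f'(z) have that sign
    too, or vanish. By partial fractions their sum is, up to the leading
    coefficient of f, the coefficient of degree d - 1 of g_mu
    [partial_fractions_lead], which is mu^T adj(E) conj(mu). Thus this form has
    a fixed sign. It is zero only if every g_mu(z) is zero, and then
    adj(N(t)) conj(mu), of degree less than d, vanishes at d points, hence
    identically; multiplying by N(t) gives mu = 0. So adj(E) is definite
    [interlacer_adj_definite], and with it E.

    Irreducibility of f provides the line [generic_line]. For an indeterminate
    point x of a complement of e, the polynomial f(t e + x) is irreducible over
    the ring of polynomials in x, so by Gauss's lemma it is coprime to every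
    nonzero polynomial of smaller degree in t, in particular to its derivative
    and to g_lam(t e + x). Clearing denominators in the two Bezout identities
    leaves nonzero polynomials in x, and any a at which they do not vanish
    will do. Gauss's lemma needs irreducible polynomials in several variables
    to be prime, which is proved by induction on the number of variables
    [mpoly_irreducible_prime]. *)

(** * Gauss's lemma over a ring with prime irreducibles *)

Definition irreducible_elt (A : idomainType) (a : A) : Prop :=
  [/\ a != 0, a \isn't a GRing.unit &
      forall b c : A, a = b * c -> b \is a GRing.unit \/ c \is a GRing.unit].

Definition divides (A : idomainType) (a b : A) : Prop := exists q, b = q * a.

Definition prime_elt (A : idomainType) (a : A) : Prop :=
  forall b c : A, divides a (b * c) -> divides a b \/ divides a c.

Lemma size_poly_unit (A : idomainType) (T : {poly A}) :
  T \is a GRing.unit -> size T = 1%N.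
Proof. by rewrite poly_unitE => /andP[/eqP]. Qed.

(** Unique factorization in A enters only as the primality of irreducible
    elements; the additive function deg, zero exactly at the units, replaces
    the ascending chain condition. *)
Section GaussLemma.
Variables (A : idomainType) (deg : A -> nat).
Hypothesis degM : forall b c, b != 0 -> c != 0 -> deg (b * c) = (deg b + deg c)%N.
Hypothesis deg_unit : forall b, b != 0 -> (b \is a GRing.unit) = (deg b == 0%N).
Hypothesis irr_prime : forall p : A, irreducible_elt p -> prime_elt p.

Lemma irreducible_factor (c : A) : c != 0 -> c \isn't a GRing.unit ->
  exists p c', irreducible_elt p /\ c = p * c'.
Proof.
have [k] := ubnP (deg c); elim: k c => // k IHk c; rewrite ltnS => le_ck c0 cNu.
have [irr_c|] := pselect (irreducible_elt c).
  by exists c, 1; rewrite mulr1.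
move=> Nirr; have [b [b' [Dc [bNu b'Nu]]]] :
    exists b b', c = b * b' /\ b \isn't a GRing.unit /\ b' \isn't a GRing.unit.
  apply: contrapT => Nex; apply: Nirr; split=> // b b' Dc.
  have [|bNu] := boolP (b \is a GRing.unit); first by left.
  have [|b'Nu] := boolP (b' \is a GRing.unit); first by right.
  by case: Nex; exists b, b'.
move: c0; rewrite Dc mulf_eq0 negb_or => /andP[b0 b'0].
have lt_bk : (deg b < k)%N.
  apply: leq_trans le_ck; rewrite Dc degM // -[ltnLHS]addn0 ltn_add2l lt0n.
  by rewrite -deg_unit.
have [p [q [irr_p Db]]] := IHk b lt_bk b0 bNu.
by exists p, (q * b'); rewrite mulrA -Db.
Qed.

(** If p divides neither factor, cancelling the leading terms divisible by p
    leads to two polynomials whose leading coefficients p does not divide, and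
    then p does not divide the leading coefficient of the product. *)
Lemma prime_dvd_polyM (p : A) (P Q H : {poly A}) : prime_elt p ->
  P * Q = p *: H -> (exists P', P = p *: P') \/ (exists Q', Q = p *: Q').
Proof.
move=> pr_p; have [k] := ubnP (size P + size Q)%N.
elim: k P Q H => // k IHk P Q H; rewrite ltnS => le_k DH.
have [->|P0] := eqVneq P 0; first by left; exists 0; rewrite scaler0.
have [->|Q0] := eqVneq Q 0; first by right; exists 0; rewrite scaler0.
have lt_tail (T : {poly A}) : T != 0 ->
    (size (T - lead_coef T *: 'X^((size T).-1))%R < size T)%N.
  move=> T0; rewrite [ltnRHS](polySpred T0) ltnS; apply/leq_sizeP => i le_i.
  rewrite coefB coefZ coefXn; move: le_i; rewrite leq_eqVlt => /orP[/eqP <-|].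
    by rewrite eqxx mulr1 lead_coefE subrr.
  move=> lt_i; rewrite gtn_eqF // mulr0 subr0 nth_default //.
  by rewrite [leqLHS](polySpred T0).
have : divides p (lead_coef P * lead_coef Q).
  exists (H`_(size (P * Q)).-1).
  by rewrite -lead_coefM lead_coefE {1}DH coefZ mulrC.
case/pr_p => -[u Du].
- have eqP1 : (P - lead_coef P *: 'X^((size P).-1)) * Q
      = p *: (H - u *: 'X^((size P).-1) * Q).
    by rewrite mulrBl DH Du scalerBr -!scalerAl scalerA [p * u]mulrC.
  case: (IHk _ _ _ _ eqP1); [|move=> [P' DP]; left|by right].
    by apply: leq_trans le_k; rewrite ltn_add2r lt_tail.
  exists (P' + u *: 'X^((size P).-1)).
  by rewrite scalerDr -DP scalerA [p * u]mulrC -Du subrK.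
- have eqP1 : P * (Q - lead_coef Q *: 'X^((size Q).-1))
      = p *: (H - u *: P * 'X^((size Q).-1)).
    by rewrite mulrBr DH Du scalerBr -!scalerAl -scalerAr scalerA [p * u]mulrC.
  case: (IHk _ _ _ _ eqP1); [|by left|move=> [Q' DQ]; right].
    by apply: leq_trans le_k; rewrite ltn_add2l lt_tail.
  exists (Q' + u *: 'X^((size Q).-1)).
  by rewrite scalerDr -DQ scalerA [p * u]mulrC -Du subrK.
Qed.

(** A factorization with denominator c descends to A, because each prime factor
    of c can be cancelled from P or from Q. Recording how c is shared between P
    and Q shows that the degrees of the factors do not change. *)
Lemma gauss_factor (c : A) (F P Q : {poly A}) : c != 0 -> c *: F = P * Q ->
  exists a b P' Q', [/\ c = a * b, P = a *: P', Q = b *: Q' & F = P' * Q'].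
Proof.
have [k] := ubnP (deg c); elim: k c P Q => // k IHk c P Q.
rewrite ltnS => le_ck c0 DF.
have [cu|cNu] := boolP (c \is a GRing.unit).
  exists c, 1, (c^-1 *: P), Q; rewrite mulr1 scalerA divrr // !scale1r.
  by rewrite -scalerAl -DF scalerA mulVr // scale1r.
have [p [c' [irr_p Dc]]] := irreducible_factor c0 cNu.
have [p0 pNu _] := irr_p.
have c'0 : c' != 0 by apply: contraNneq c0 => c'0; rewrite Dc c'0 mulr0.
have lt_c' : (deg c' < k)%N.
  apply: leq_trans le_ck; rewrite Dc degM // -[ltnLHS]add0n ltn_add2r lt0n.
  by rewrite -deg_unit.
have pI (U V : {poly A}) : p *: U = p *: V -> U = V.
  by rewrite -!mul_polyC; apply: mulfI; rewrite polyC_eq0.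
have : P * Q = p *: (c' *: F) by rewrite scalerA -Dc.
case/(prime_dvd_polyM (irr_prime irr_p)) => -[T DT].
- have [|a [b [P' [Q' [Dc' DT' DQ' DF']]]]] := IHk c' T Q lt_c' c'0.
    by apply: pI; rewrite scalerA -Dc DF DT scalerAl.
  by exists (p * a), b, P', Q'; rewrite -mulrA -Dc' -scalerA -DT'.
- have [|a [b [P' [Q' [Dc' DT' DQ' DF']]]]] := IHk c' P T lt_c' c'0.
    by apply: pI; rewrite scalerA -Dc DF DT scalerAr.
  by exists a, (p * b), P', Q'; rewrite mulrCA -Dc' -scalerA -DQ'.
Qed.

(** A gcd of positive degree gives a factorization of F up to a scalar, hence
    by [gauss_factor] an honest one, whose cofactor must be a unit. The
    divisibility in the conclusion is pseudo-divisibility, that is,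
    divisibility over the fraction field. *)
Lemma irreducible_dvdp (F G : {poly A}) : irreducible_elt F ->
  ~~ coprimep F G -> F %| G.
Proof.
move=> [F0 _ irrF] NcFG.
have /(@Pdiv.Idomain.dvdpP A)[[c Q] /= c0 DF] := dvdp_gcdl F G.
have [a [b [Q' [D' [Dc DQ DD DF']]]]] := gauss_factor c0 DF.
have b0 : b != 0 by apply: contraNneq c0 => b0; rewrite Dc b0 mulr0.
have : size (gcdp F G) == size F.
  rewrite DD size_scale //; case: (irrF _ _ DF') => [Q'u | D'u].
    have /size_poly1P[q q0 DQ'] : size Q' == 1%N by rewrite size_poly_unit.
    by rewrite DF' DQ' mul_polyC size_scale.
  case/negP: NcFG; rewrite coprimep_def DD size_scale //.
  by rewrite size_poly_unit.
by rewrite dvdp_size_eqp ?dvdp_gcdl // => /eqp_dvdl <-; rewrite dvdp_gcdr.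
Qed.

(** The induction step of unique factorization: constants are handled by
    [prime_dvd_polyM]; in positive degree F divides a factor over the fraction
    field, and irreducibility prevents a denominator. *)
Lemma irreducible_poly_prime (F : {poly A}) : irreducible_elt F -> prime_elt F.
Proof.
move=> irrF; have [F0 FNu irrFM] := irrF.
have [sF|sFN1] := eqVneq (size F) 1%N; last first.
  suff dvdF (G : {poly A}) : F %| G -> divides F G.
    move=> P Q [H DH]; have [cFP|NcFP] := boolP (coprimep F P); last first.
      by left; apply/dvdF/irreducible_dvdp.
    by right; apply: dvdF; rewrite -(Gauss_dvdpr _ cFP) DH dvdp_mull.
  case/(@Pdiv.Idomain.dvdpP A) => -[c q] /= c0 DG.
  have [a [b [q' [F' [Dc _ DF Dp]]]]] := gauss_factor c0 DG.
  have b0 : b != 0 by apply: contraNneq c0 => b0; rewrite Dc b0 mulr0.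
  have bu : b \is a GRing.unit.
    have [|bu|F'u] := irrFM b%:P F'; first by rewrite mul_polyC.
    - by move: bu; rewrite poly_unitE coefC => /andP[].
    - by case/eqP: sFN1; rewrite DF size_scale // size_poly_unit.
  (* F = b F' forces b to be a unit, so that G = q' F' is a multiple of F *)
  by exists (b^-1 *: q'); rewrite Dp DF -scalerAl -scalerAr scalerA mulVr ?scale1r.
have /size_poly1P[p p0 DF] : size F == 1%N by rewrite sF.
have pr_p : prime_elt p.
  apply: irr_prime; split=> // [|b c Dp].
    by apply: contraNN FNu => pu; rewrite DF poly_unitE size_polyC p0 coefC.
  have [] := irrFM b%:P c%:P; first by rewrite DF Dp polyCM.
    by rewrite poly_unitE coefC => /andP[_]; left.
  by rewrite poly_unitE coefC => /andP[_]; right.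
move=> P Q [H DH]; case: (@prime_dvd_polyM p P Q H pr_p).
- by rewrite DH DF mulrC mul_polyC.
- by case=> P' DP; left; exists P'; rewrite DP DF mulrC mul_polyC.
- by case=> P' DP; right; exists P'; rewrite DP DF mulrC mul_polyC.
Qed.

End GaussLemma.

(** * Unique factorization in multivariate polynomial rings *)

Lemma rmorph_mmap (n : nat) (K : nzRingType) (S T : comNzRingType)
    (g : {rmorphism S -> T}) (f : {rmorphism K -> S}) (h : 'I_n -> S) p :
  g (mmap f h p) = mmap (g \o f) (g \o h) p.
Proof.
rewrite /mmap rmorph_sum; apply: eq_bigr => m _.
rewrite rmorphM /= /mmap1 rmorph_prod; congr (_ * _).
by apply: eq_bigr => i _; rewrite rmorphXn.
Qed.

Lemma eq_mmap (n : nat) (K : nzRingType) (S : comNzRingType)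
    (f f' : K -> S) (h h' : 'I_n -> S) p :
  f =1 f' -> h =1 h' -> mmap f h p = mmap f' h' p.
Proof.
move=> eqf eqh; apply: eq_bigr => m _; rewrite eqf; congr (_ * _).
exact: mmap1_eq.
Qed.

Lemma mmap_id (n : nat) (K : comNzRingType) (p : {mpoly K[n]}) :
  mmap (@mpolyC n K) (fun i => 'X_i) p = p.
Proof.
by rewrite -[RHS]comp_mpoly_id; apply: eq_mmap => // i; rewrite tnth_mktuple.
Qed.

Lemma mmap_map_mpoly (n : nat) (K L S : comNzRingType)
    (u : {rmorphism K -> L}) (f : {rmorphism L -> S}) (h : 'I_n -> S) p :
  mmap f h (map_mpoly u p) = mmap (f \o u) h p.
Proof.
rewrite /map_mpoly rmorph_mmap; apply: eq_mmap => [c|i] /=.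
  by rewrite mmapC.
by rewrite mmapX mmap1U.
Qed.

(** The vectors of the canonical basis other than the j-th one span a
    complement of e as soon as e_j is nonzero. In the coordinates t along e and
    x in this complement, {mpoly K[n.+1]} is {poly {mpoly K[n]}}; the change of
    variables is written in both directions so that irreducibility and
    primality can be transported. *)
Section LineCoordinates.
Variables (K : fieldType) (n : nat) (e : 'I_n.+1 -> K) (j : 'I_n.+1).
Hypothesis ej : e j != 0.

Definition transversal_point (T : nmodType) (x : 'I_n -> T) (i : 'I_n.+1) : T :=
  if unlift j i is Some k then x k else 0.

Definition split_line : {mpoly K[n.+1]} -> {poly {mpoly K[n]}} :=
  mmap (polyC \o @mpolyC n K)
    (fun i => (e i)%:MP *: 'X + (transversal_point (fun k => 'X_k) i)%:P).
HB.instance Definition _ := GRing.RMorphism.on split_line.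

Definition skew_coords : {mpoly K[n]} -> {mpoly K[n.+1]} :=
  mmap (@mpolyC n.+1 K) (fun k => 'X_(lift j k) - (e (lift j k) / e j) *: 'X_j).
HB.instance Definition _ := GRing.RMorphism.on skew_coords.

Definition unsplit_line : {poly {mpoly K[n]}} -> {mpoly K[n.+1]} :=
  horner_eval ((e j)^-1 *: 'X_j) \o map_poly skew_coords.
HB.instance Definition _ := GRing.RMorphism.on unsplit_line.

Lemma split_lineX i : split_line 'X_i =
  (e i)%:MP *: 'X + (transversal_point (fun k => 'X_k) i)%:P.
Proof. by rewrite /split_line mmapX mmap1U. Qed.

Lemma split_lineC c : split_line c%:MP = c%:MP%:P.
Proof. by rewrite /split_line mmapC. Qed.

Lemma split_lineK : cancel split_line unsplit_line.
Proof.
move=> p; rewrite /split_line rmorph_mmap -[RHS]mmap_id; apply: eq_mmap => [c|i] /=.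
  by rewrite /unsplit_line /= map_polyC /= /horner_eval hornerC /skew_coords mmapC.
rewrite /unsplit_line /= rmorphD /= map_polyZ /= map_polyX map_polyC /=.
rewrite /horner_eval hornerD hornerZ hornerX hornerC /skew_coords mmapC.
rewrite mul_mpolyC scalerA /transversal_point; case: unliftP => [k|] ->.
  by rewrite mmapX mmap1U addrC subrK.
by rewrite raddf0 addr0 divff // scale1r.
Qed.

Lemma split_skew_coords p : split_line (skew_coords p) = p%:P.
Proof.
rewrite /skew_coords rmorph_mmap -[X in _ = X%:P]mmap_id rmorph_mmap.
apply: eq_mmap => [c|k] /=; first by rewrite split_lineC.
rewrite raddfB /= -mul_mpolyC rmorphM /= split_lineC !split_lineX.
rewrite /transversal_point liftK unlift_none addr0 mul_polyC scalerA -mpolyCM.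
by rewrite divfK // addrAC subrr add0r.
Qed.

Lemma unsplit_lineK : cancel unsplit_line split_line.
Proof.
move=> P; rewrite /unsplit_line /= /horner_eval -horner_map -map_poly_comp /=.
rewrite (eq_map_poly (g := polyC)) => [|c]; last exact: split_skew_coords.
rewrite -mul_mpolyC rmorphM /= split_lineC split_lineX /transversal_point.
rewrite unlift_none addr0 mul_polyC scalerA -mpolyCM mulVf // mpolyC1 scale1r.
exact: comp_polyXr.
Qed.

Lemma irreducible_split_line f : irreducible_elt f -> irreducible_elt (split_line f).
Proof.
case=> f0 fNu irrf; split.
- by apply: contraNneq f0 => F0; rewrite -[f]split_lineK F0 rmorph0.
- by apply: contraNN fNu => Fu; rewrite -[f]split_lineK rmorph_unit.
move=> P Q DF; have [|Pu|Qu] := irrf (unsplit_line P) (unsplit_line Q).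
- by rewrite -(rmorphM unsplit_line) -DF /= split_lineK.
- by left; rewrite -[P]unsplit_lineK rmorph_unit.
- by right; rewrite -[Q]unsplit_lineK rmorph_unit.
Qed.

Lemma prime_split_line f : prime_elt (split_line f) -> prime_elt f.
Proof.
move=> prF b c [q Dq]; have [|[u Du]|[u Du]] := prF (split_line b) (split_line c).
- exists (split_line q); have := congr1 split_line Dq.
  by rewrite (rmorphM split_line b c) (rmorphM split_line q f).
- by left; exists (unsplit_line u); rewrite -[b]split_lineK Du rmorphM /= split_lineK.
- by right; exists (unsplit_line u); rewrite -[c]split_lineK Du rmorphM /= split_lineK.
Qed.

End LineCoordinates.

Section MpolyUFD.
Variable K : fieldType.

Lemma mpoly_degM n (b c : {mpoly K[n]}) : b != 0 -> c != 0 ->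
  (msize (b * c)).-1 = ((msize b).-1 + (msize c).-1)%N.
Proof.
move=> b0 c0; rewrite msizeM //; move: b0 c0; rewrite -!msize_poly_eq0.
by case: (msize b) (msize c) => // x [] //= y _ _; rewrite addnS.
Qed.

Lemma mpoly_deg_unit n (b : {mpoly K[n]}) :
  b != 0 -> (b \is a GRing.unit) = ((msize b).-1 == 0%N).
Proof.
move=> b0; have -> : ((msize b).-1 == 0%N) = (msize b == 1%N).
  by move: b0; rewrite -msize_poly_eq0; case: (msize b).
apply/idP/msize_poly1P => [|[c c0 ->]].
  by move/andP=> [/eqP Db]; rewrite unitfE => b_0; exists b@_0.
by rewrite rmorph_unit // unitfE.
Qed.

(** Any direction with a nonzero coordinate exhibits the ring in n + 1 variables
    as a univariate polynomial ring over the ring in n variables, to which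
    Gauss's lemma applies. *)
Theorem mpoly_irreducible_prime n (f : {mpoly K[n]}) :
  irreducible_elt f -> prime_elt f.
Proof.
elim: n f => [|n IHn] f irrf.
  have [f0 /negP[]] := irrf.
  by rewrite mpoly_deg_unit // [f]nvar0_mpolyC msizeC; case: (_ != 0).
pose e (i : 'I_n.+1) : K := 1.
have e0 : e ord0 != 0 by rewrite oner_neq0.
apply: (prime_split_line e0).
apply: (irreducible_poly_prime (@mpoly_degM n) (@mpoly_deg_unit n) IHn).
exact: irreducible_split_line.
Qed.

End MpolyUFD.

(** * Restriction to lines and the generic line *)

Section LinePoly.
Variables (K : comNzRingType) (m : nat).
Implicit Types (f : {mpoly K[m]}) (e a : 'I_m -> K).

Lemma map_line_poly (L : comNzRingType) (u : {rmorphism K -> L}) f e a :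
  map_poly u (line_poly f e a) = line_poly (map_mpoly u f) (u \o e) (u \o a).
Proof.
rewrite /line_poly mmap_map_mpoly rmorph_mmap; apply: eq_mmap => [c|i] /=.
  by rewrite map_polyC.
by rewrite rmorphD /= map_polyZ map_polyX map_polyC.
Qed.

Lemma horner_line_poly f e a t :
  (line_poly f e a).[t] = f.@[fun i => e i * t + a i].
Proof.
rewrite -/(horner_eval t _) /line_poly rmorph_mmap /meval.
apply: eq_mmap => [c|i] /=; rewrite /horner_eval ?hornerC //.
by rewrite hornerD hornerZ hornerX hornerC.
Qed.

(** Every linear factor of a monomial of degree k contributes its t-coefficient
    e_i to the coefficient of degree k. *)
Lemma dhomog_line_poly f e a k : f \is k.-homog ->
  (size (line_poly f e a) <= k.+1)%N /\ (line_poly f e a)`_k = f.@[e].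
Proof.
move=> /dhomogP hf.
have linP (u v : K) : (size (u *: 'X + v%:P)%R <= 2)%N.
  rewrite (leq_trans (size_polyD _ _)) // geq_max (leq_trans (size_scale_leq _ _)) ?size_polyX //.
  by rewrite (leq_trans (size_polyC_leq1 _)).
have mulP (p q : {poly K}) r s : (size p <= r.+1)%N -> (size q <= s.+1)%N ->
    (size (p * q)%R <= (r + s).+1)%N /\ (p * q)`_(r + s) = p`_r * q`_s.
  move=> sp sq; split.
    apply: leq_trans (size_polyMleq _ _) _.
    by have := leq_add sp sq; rewrite addnS addSn; case: (_ + _)%N.
  rewrite coefM (bigD1 (inord r)) //= inordK ?ltnS ?leq_addr // addKn.
  rewrite big1 ?addr0 // => i /negP ir; case: (ltngtP i r) => [lt_ir|lt_ri|eq_ir].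
  - rewrite [q`__]nth_default ?mulr0 // (leq_trans sq) //.
    by rewrite ltn_subRL ltn_add2r.
  - by rewrite nth_default ?mul0r // (leq_trans sp).
  - by case: ir; apply/eqP/val_inj; rewrite /= inordK ?ltnS ?leq_addr.
have expM (p : {poly K}) r : (size p <= 2)%N ->
    (size (p ^+ r)%R <= r.+1)%N /\ (p ^+ r)`_r = p`_1 ^+ r.
  move=> sp; elim: r => [|r [sr cr]]; first by rewrite !expr0 size_polyC leq_b1 coef1.
  by rewrite !exprS -cr; apply: (mulP _ _ 1%N r).
have monM (mn : 'X_{1..m}) (h : 'I_m -> {poly K}) (H : forall i, (size (h i) <= 2)%N) :
    (size (mmap1 h mn) <= (mdeg mn).+1)%N
    /\ (mmap1 h mn)`_(mdeg mn) = mmap1 (fun i => (h i)`_1) mn.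
  rewrite /mmap1 mdegE.
  apply: (big_ind3 (fun (p : {poly K}) k c => (size p <= k.+1)%N /\ p`_k = c)).
  - by rewrite size_polyC leq_b1 coef1.
  - by move=> p r c q s c' [sp <-] [sq <-]; apply: mulP.
  - by move=> i _; apply: expM.
split.
  apply: leq_trans (size_sum _ _ _) _; apply/bigmax_leqP_seq => mn mnf _.
  rewrite mul_polyC (leq_trans (size_scale_leq _ _)) // -(hf _ mnf).
  by have [] := monM mn _ (fun i => linP (e i) (a i)).
rewrite coef_sum mevalE; apply: eq_big_seq => mn mnf.
rewrite coefCM -(hf _ mnf); have [_ ->] := monM mn _ (fun i => linP (e i) (a i)).
congr (_ * _); apply: eq_bigr => i _.
by rewrite coefD coefZ coefX coefC addr0 mulr1.
Qed.

End LinePoly.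

Lemma dhomog_map_mpoly (K L : nzRingType) (u : {rmorphism K -> L}) m k
    (f : {mpoly K[m]}) : f \is k.-homog -> map_mpoly u f \is k.-homog.
Proof.
move=> /dhomogP hf; apply/dhomogP => mn.
rewrite mcoeff_msupp mcoeff_map_mpoly => ufn; apply: hf.
by rewrite mcoeff_msupp; apply: contraNneq ufn => ->; rewrite raddf0.
Qed.

Section GenericLine.
Variable (K : numFieldType).

Lemma poly_nonroot (p : {poly K}) : p != 0 -> exists t, p.[t] != 0.
Proof.
move=> p0; apply: contrapT => Nex.
have rootp t : root p t.
  by rewrite /root; apply/negPn/negP => pt; case: Nex; exists t.
suff: (size [seq i%:R : K | i <- iota 0 (size p)] < size p)%N.
  by rewrite size_map size_iota ltnn.
apply: max_poly_roots => //; first by apply/allP => t _.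
by rewrite map_inj_uniq ?iota_uniq // => i k /eqP; rewrite eqr_nat => /eqP.
Qed.

Section Direction.
Variables (n : nat) (e : 'I_n.+1 -> K) (j : 'I_n.+1).
Hypothesis ej : e j != 0.

Lemma split_line_at (f : {mpoly K[n.+1]}) x :
  map_poly (meval x) (split_line e j f) = line_poly f e (transversal_point j x).
Proof.
rewrite /split_line rmorph_mmap /line_poly; apply: eq_mmap => [c|i] /=.
  by rewrite map_polyC /= mevalC.
rewrite rmorphD /= map_polyZ map_polyX map_polyC /= mevalC; congr (_ + _%:P).
by rewrite /transversal_point; case: unlift => [k|]; rewrite ?mevalXU ?meval0.
Qed.

Lemma split_lineE (f : {mpoly K[n.+1]}) : split_line e j f =
  line_poly (map_mpoly (@mpolyC n K) f) (fun i => (e i)%:MP)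
    (transversal_point j (fun k => 'X_k)).
Proof. by rewrite /line_poly mmap_map_mpoly. Qed.

Lemma split_line_neq0 (f : {mpoly K[n.+1]}) : f != 0 -> split_line e j f != 0.
Proof. by apply: contraNneq => F0; rewrite -[f](split_lineK ej) F0 rmorph0. Qed.

Lemma dhomog_split_line (f : {mpoly K[n.+1]}) k : f \is k.-homog ->
  (size (split_line e j f) <= k.+1)%N /\ (split_line e j f)`_k = (f.@[e])%:MP.
Proof.
move=> hf; rewrite split_lineE.
have [|-> ->] := @dhomog_line_poly _ _ (map_mpoly (@mpolyC n K) f)
  (fun i => (e i)%:MP) (transversal_point j (fun k => 'X_k)) k.
  exact: dhomog_map_mpoly.
split=> //; rewrite /meval mmap_map_mpoly rmorph_mmap; exact: eq_mmap.
Qed.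

End Direction.

(** Choose first the coordinates transversal to a direction, so that the leading
    coefficient along it does not vanish, and then the coordinate along it. *)
Lemma mpoly_nonzero_at n (f : {mpoly K[n]}) : f != 0 -> exists x, f.@[x] != 0.
Proof.
elim: n f => [|n IHn] f f0.
  exists (fun=> 0); move: f0; rewrite [f]nvar0_mpolyC mevalC.
  by apply: contraNneq => ->; rewrite mpolyC0.
pose e (i : 'I_n.+1) : K := 1.
have e0 : e ord0 != 0 by rewrite oner_neq0.
have [x Fx] := IHn (lead_coef (split_line e ord0 f))
  (etrans (congr1 negb (lead_coef_eq0 _)) (split_line_neq0 e0 f0)).
have [|t Ft] := @poly_nonroot (map_poly (meval x) (split_line e ord0 f)).
  apply: contraNneq Fx => F0; rewrite lead_coefE -coef_map F0.
  by rewrite coef0.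
exists (fun i => e i * t + transversal_point ord0 x i).
by rewrite -horner_line_poly -split_line_at.
Qed.

(** The constant c is the right-hand side of a Bezout identity cleared of
    denominators. Unlike an argument by resultants, specializing the identity
    is not disturbed by a drop of degree. *)
Lemma coprimep_mpoly_at n (F G : {poly {mpoly K[n]}}) : coprimep F G ->
  exists2 c, c != 0 & forall x : 'I_n -> K, c.@[x] != 0 ->
    coprimep (map_poly (meval x) F) (map_poly (meval x) G).
Proof.
case/Bezout_coprimepP => -[u v] /= /eqpP[[c c'] /= /andP[c0 c'0] Dc].
exists c' => // x c'x; apply/Bezout_coprimepP.
pose s p := map_poly (meval x) (c *: p); exists (s u, s v).
rewrite /= /s -!rmorphM -rmorphD -!scalerAl -scalerDr Dc.
by rewrite alg_polyC /= map_polyC /= polyC_eqp1.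
Qed.

(** On a general line parallel to e, the polynomial f has simple zeros and shares
    none with g: over the ring of polynomials in the transversal coordinates,
    the irreducible polynomial f is coprime to its derivative in t and to g,
    which have smaller degree in t. *)
Theorem generic_line n d (f g : {mpoly K[n.+1]}) (e : 'I_n.+1 -> K) :
  irreducible_elt f -> f \is d.+1.-homog -> f.@[e] != 0 ->
  g != 0 -> g \is d.-homog ->
  exists a, let p := line_poly f e a in
    coprimep p p^`() /\ coprimep p (line_poly g e a).
Proof.
move=> irrf hf fe g0 hg.
(* f vanishes at 0, so that e is not 0 *)
have [j ej] : exists j, e j != 0.
  apply: contrapT => Nex; case/negP: fe; apply/eqP.
  rewrite mevalE big_seq big1 // => mn mnf.
  have : mdeg mn != 0%N by rewrite (dhomogP _ _ _ hf _ mnf).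
  rewrite mdeg_eq0 => /eqP/mnmP mn0.
  have [i mni] : exists i, mn i != 0%N.
    apply: contrapT => Nexi; apply: mn0 => i; rewrite mnm0E.
    by apply/eqP/negPn/negP => mni; apply: Nexi; exists i.
  have ei : e i = 0 by apply/eqP/negPn/negP => ei; apply: Nex; exists i.
  by rewrite (bigD1 i) //= ei expr0n (negPf mni) mul0r mulr0.
have irrF := irreducible_split_line ej irrf.
set F := split_line e j f in irrF; set G := split_line e j g.
have [sF leadF] := dhomog_split_line e j hf.
have sFE : size F = d.+2.
  apply/eqP; rewrite eqn_leq sF ltnNge; apply/negP => sF'.
  by move: leadF; rewrite nth_default // => /esym/eqP; rewrite mpolyC_eq0 (negPf fe).
have coF (H : {poly {mpoly K[n]}}) : H != 0 -> (size H <= d.+1)%N -> coprimep F H.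
  move=> H0 sH; apply: contraT => NcFH.
  have dvdFH : F %| H.
    apply: irreducible_dvdp irrF NcFH.
    - exact: mpoly_degM.
    - exact: mpoly_deg_unit.
    exact: mpoly_irreducible_prime.
  by have := dvdp_leq H0 dvdFH; rewrite sFE leqNgt ltnS sH.
have [c c0 cP] : exists2 c, c != 0 & forall x : 'I_n -> K, c.@[x] != 0 ->
    coprimep (map_poly (meval x) F) (map_poly (meval x) F^`()).
  apply/coprimep_mpoly_at/coF.
    have : F^`()`_d != 0.
      rewrite coef_deriv leadF -mpolyCMn mpolyC_eq0 -mulr_natr mulf_eq0 (negPf fe).
      by rewrite pnatr_eq0.
    by apply: contraNneq => ->; rewrite coef0.
  by rewrite -ltnS -sFE lt_size_deriv // -size_poly_eq0 sFE.
have [c' c'0 c'P] := coprimep_mpoly_at (coF G (split_line_neq0 ej g0)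
  (dhomog_split_line e j hg).1).
have [x] := mpoly_nonzero_at (mulf_neq0 c0 c'0).
rewrite mevalM mulf_eq0 negb_or => /andP[/cP coFx /c'P coGx].
exists (transversal_point j x) => /=.
by rewrite -!split_line_at deriv_map; split.
Qed.

End GenericLine.

(** * Interlacing of real polynomials *)

(** Interlacing of sorted lists is a comparison of counting functions: the number
    of entries below any z differs by 0 or 1. In this form the insertion of the
    same entry in both lists is harmless. *)
Section SortedCounts.
Variable R : realType.
Implicit Types (s t : seq R) (z : R).

Lemma lt_nth_count s i z : sorted <=%R s -> (i < size s)%N ->
  (s`_i < z) = (i < count (< z) s)%N.
Proof.
move=> ss lt_is; apply/idP/idP => [|?]; last exact: nth_count_lt.
by apply: contraTT; rewrite -leqNgt -leNgt => le_i; apply: nth_count_ge => //; rewrite le_i.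
Qed.

(** The shift k serves both halves of the interlacing condition, with k = 0 and
    k = 1. *)
Lemma nth_le_count s t k : sorted <=%R s -> sorted <=%R t ->
  (size s <= size t + k)%N ->
  (forall i, (i + k < size s)%N -> t`_i <= s`_(i + k)) <->
  (forall z, (count (< z) s <= count (< z) t + k)%N).
Proof.
move=> ss st le_st; split=> [le_ts z|le_c i lt_i].
  have [//|lt_k] := leqP (count (< z) s) (count (< z) t + k)%N.
  set c := count (< z) t in lt_k *.
  have lt_cs : (c + k < size s)%N := leq_trans lt_k (count_size _ _).
  have lt_ct : (c < size t)%N by rewrite -(ltn_add2r k) (leq_trans lt_cs).
  have := le_lt_trans (le_ts c lt_cs) (_ : _ < z).
  by rewrite !lt_nth_count // ltnn; apply.
rewrite leNgt; apply/negP; rewrite lt_nth_count // => lt_ik.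
have lt_it : (i < size t)%N by rewrite -(ltn_add2r k) (leq_trans lt_i).
have := leq_trans lt_ik (le_c t`_i).
by rewrite ltn_add2r -lt_nth_count // ltxx.
Qed.

Definition interlacing (beta alpha : seq R) : Prop :=
  size alpha = (size beta).+1 /\
  forall i : nat, (i < size beta)%N -> alpha`_i <= beta`_i /\ beta`_i <= alpha`_i.+1.

Lemma interlacing_count (beta alpha : seq R) :
  sorted <=%R beta -> sorted <=%R alpha -> size alpha = (size beta).+1 ->
  interlacing beta alpha <->
  forall z, (count (< z) beta <= count (< z) alpha <= (count (< z) beta).+1)%N.
Proof.
move=> sb sa sz.
have le0 : (size beta <= size alpha + 0)%N by rewrite sz addn0.
have le1 : (size alpha <= size beta + 1)%N by rewrite sz addn1.
have [c0 n0] := nth_le_count sb sa le0; have [c1 n1] := nth_le_count sa sb le1.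
split=> [[_ leab] z|le_c]; last first.
  split=> // i lt_i; split.
    rewrite -[in leRHS](addn0 i); apply: n0; rewrite ?addn0 // => z.
    by rewrite addn0; case/andP: (le_c z).
  rewrite -[in leRHS]addn1; apply: n1; rewrite ?addn1 ?sz // => z.
  by rewrite addn1; case/andP: (le_c z).
apply/andP; split.
  rewrite -[leqRHS]addn0; apply: c0 => i; rewrite addn0 => lt_i.
  by case: (leab i lt_i).
rewrite -addn1; apply: c1 => i; rewrite addn1 sz ltnS => lt_i.
by case: (leab i lt_i).
Qed.

End SortedCounts.

Section Interlacing.
Variable R : realType.
Implicit Types (p q : {poly R}) (s t : seq R).

Lemma interlacesZ (a b : R) q p : a != 0 -> b != 0 ->
  interlaces q p -> interlaces (a *: q) (b *: p).
Proof.
move=> a0 b0 [alpha [beta [[p0 sa Dp] [q0 sb Dq] sz leab]]].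
exists alpha, beta; split=> //.
- by rewrite /ordered_zeros scaler_eq0 negb_or b0 p0 lead_coefZ -scalerA -Dp.
- by rewrite /ordered_zeros scaler_eq0 negb_or a0 q0 lead_coefZ -scalerA -Dq.
Qed.

Lemma ordered_zerosM x p s : ordered_zeros p s ->
  ordered_zeros (('X - x%:P) * p) (sort <=%R (x :: s)).
Proof.
move=> [p0 ss Dp]; split.
- by rewrite mulf_neq0 // polyXsubC_eq0.
- exact: sort_le_sorted.
rewrite (perm_big (x :: s)) ?perm_sort //= big_cons lead_coefM.
by rewrite lead_coefXsubC mul1r scalerAr -Dp.
Qed.

(** This is how common zeros, and with them multiple zeros of p, are removed in
    [cone_interlaces]. *)
Lemma interlacesM x q p : interlaces q p ->
  interlaces (('X - x%:P) * q) (('X - x%:P) * p).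
Proof.
move=> [alpha [beta [za zb sz leab]]].
have [_ sa _] := za; have [_ sb _] := zb.
exists (sort <=%R (x :: alpha)), (sort <=%R (x :: beta)).
have szx : size (sort <=%R (x :: alpha)) = (size (sort <=%R (x :: beta))).+1.
  by rewrite !size_sort /= sz.
suff [_ ?] : interlacing (sort <=%R (x :: beta)) (sort <=%R (x :: alpha)).
  by split=> //; apply: ordered_zerosM.
apply/interlacing_count => // [||z]; try exact: sort_le_sorted.
have /interlacing_count : interlacing beta alpha by [].
by move/(_ sb sa sz z); rewrite !count_sort /= leq_add2l -addnS leq_add2l.
Qed.

Section Cone.
Variables (I : finType) (x : I -> R).
Implicit Types (w : I -> R) (J : {set I}).

(** Index sets J, rather than lists of nodes, make it easy to discard a node while
    the weights are modified. *)
Definition node_poly J := \prod_(j in J) ('X - (x j)%:P).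
Definition cone_poly w J := \sum_(i in J) w i *: node_poly (J :\ i).

Lemma node_polyD1 i J : i \in J -> node_poly J = ('X - (x i)%:P) * node_poly (J :\ i).
Proof. exact: big_setD1. Qed.

Lemma cone_polyD1 w i J : i \in J -> cone_poly w J =
  w i *: node_poly (J :\ i) + ('X - (x i)%:P) * cone_poly w (J :\ i).
Proof.
move=> Ji; rewrite /cone_poly (big_setD1 i) //=; congr (_ + _).
rewrite mulr_sumr; apply: eq_bigr => j; rewrite !inE => /andP[ji Jj].
rewrite -scalerAr (@node_polyD1 i) ?inE 1?eq_sym ?ji //; congr (_ *: (_ * node_poly _)).
by rewrite !setDDl setUC.
Qed.

Lemma node_poly_zeros J : node_poly J =
  \prod_(z <- sort <=%R [seq x j | j <- enum J]) ('X - z%:P).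
Proof. by rewrite (perm_big _ (permEl (perm_sort _ _))) /= big_map big_enum. Qed.

Lemma size_node_poly J : size (node_poly J) = #|J|.+1.
Proof. by rewrite node_poly_zeros size_prod_XsubC size_sort size_map -cardE. Qed.

Lemma node_poly_monic J : node_poly J \is monic.
Proof. by rewrite node_poly_zeros monic_prod_XsubC. Qed.

Lemma cone_poly_eval w i J : i \in J ->
  (cone_poly w J).[x i] = w i * (node_poly (J :\ i)).[x i].
Proof.
by move=> Ji; rewrite (cone_polyD1 _ Ji) hornerD hornerZ hornerM hornerXsubC subrr mul0r addr0.
Qed.

Lemma cone_poly_coef w J : (cone_poly w J)`_#|J|.-1 = \sum_(i in J) w i.
Proof.
rewrite coef_sum; apply: eq_bigr => i Ji; rewrite coefZ.
have /monicP := node_poly_monic (J :\ i).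
by rewrite lead_coefE size_node_poly (cardsD1 i J) Ji /= => ->; rewrite mulr1.
Qed.

Lemma size_cone_poly w J : (size (cone_poly w J) <= #|J|)%N.
Proof.
apply: leq_trans (size_sum _ _ _) _; apply/bigmax_leqP => i Ji.
by rewrite (leq_trans (size_scale_leq _ _)) // size_node_poly (cardsD1 i J) Ji.
Qed.

(** At the node x_i only the i-th term survives. So the hypothesis makes the nodes
    distinct and the weights positive, and then the values at two consecutive
    nodes have opposite signs. *)
Lemma cone_interlaces_simple w J : (0 < #|J|)%N -> (forall i, 0 <= w i) ->
  (forall i, i \in J -> (cone_poly w J).[x i] != 0) ->
  interlaces (cone_poly w J) (node_poly J).
Proof.
move=> J0 w_ge0 qx.
have w_gt0 i : i \in J -> 0 < w i.
  move=> Ji; rewrite lt_def w_ge0 andbT; apply: contraNneq (qx i Ji) => wi.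
  by rewrite cone_poly_eval // wi mul0r.
have xI : {in J &, injective x}.
  move=> i j Ji Jj xij; apply/eqP; apply: contraNT (qx i Ji) => ij.
  rewrite cone_poly_eval // (@node_polyD1 j) ?inE 1?eq_sym ?ij //.
  by rewrite hornerM hornerXsubC xij subrr mul0r mulr0.
set q := cone_poly w J in qx *.
pose alpha := sort <=%R [seq x j | j <- enum J].
have sza : size alpha = #|J| by rewrite size_sort size_map -cardE.
have sa : sorted <%R alpha.
  rewrite lt_sorted_uniq_le sort_le_sorted sort_uniq andbT map_inj_in_uniq ?enum_uniq //.
  by move=> i j; rewrite !mem_enum; apply: xI.
have alphaP k : (k < #|J|)%N -> exists2 i, i \in J & alpha`_k = x i.
  move=> lt_k; have : alpha`_k \in alpha by rewrite mem_nth ?sza.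
  by rewrite mem_sort => /mapP [l]; rewrite mem_enum; exists l.
have lt_alpha k l : (k < #|J|)%N -> (l < #|J|)%N -> (alpha`_k < alpha`_l) = (k < l)%N.
  by move=> lt_k lt_l; rewrite lt_sorted_ltn_nth // inE sza.
have signs k : (k.+1 < #|J|)%N -> q.[alpha`_k] * q.[alpha`_k.+1] < 0.
  move=> lt_k; have lt_k' := ltnW lt_k.
  have [i Ji Di] := alphaP k lt_k'; have [j Jj Dj] := alphaP k.+1 lt_k.
  have lt_ij : x i < x j by rewrite -Di -Dj lt_alpha.
  have ij : i != j by apply: contraTneq lt_ij => ->; rewrite ltxx.
  rewrite Di Dj !cone_poly_eval //.
  rewrite (@node_polyD1 j (J :\ i)) ?inE 1?eq_sym ?ij //.
  rewrite (@node_polyD1 i (J :\ j)) ?inE ?ij // !hornerM !hornerXsubC.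
  rewrite [J :\ j :\ i]setDDl [[set j] :|: _]setUC -setDDl.
  (* no node lies between the consecutive nodes x_i and x_j, so that every
     factor belonging to a third node has the same sign at both *)
  set T := J :\ i :\ j; suff T_gt0 : 0 < (node_poly T).[x i] * (node_poly T).[x j].
    have -> : w i * ((x i - x j) * (node_poly T).[x i])
        * (w j * ((x j - x i) * (node_poly T).[x j]))
      = - (w i * w j * ((x j - x i) ^+ 2)
           * ((node_poly T).[x i] * (node_poly T).[x j])) by ring.
    by rewrite oppr_lt0 mulr_gt0 // !mulr_gt0 ?w_gt0 ?subr_gt0.
  rewrite /node_poly !horner_prod -big_split /=; apply: prodr_gt0 => l.
  rewrite !inE => /and3P[lj li Jl]; rewrite !hornerXsubC.
  have : x l \in alpha by rewrite mem_sort map_f ?mem_enum.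
  move/(nthP 0) => [r]; rewrite sza => lt_r Dl.
  have [lt_rk|lt_kr|eq_rk] := ltngtP r k.
  - have lt_li : x l < x i by rewrite -Dl -Di lt_alpha.
    by rewrite mulr_gt0 // subr_gt0 // (lt_trans lt_li).
  - have [lt_rk|lt_kr1|eq_rk] := ltngtP r k.+1.
    + by move: lt_rk; rewrite ltnS leqNgt lt_kr.
    + have lt_jl : x j < x l by rewrite -Dl -Dj lt_alpha.
      by rewrite nmulr_lgt0 ?subr_lt0 // (lt_trans lt_ij).
    + by case/eqP: lj; apply: xI => //; rewrite -Dl -Dj eq_rk.
  - by case/eqP: li; apply: xI => //; rewrite -Dl -Di eq_rk.
have /choice [b bP] : forall k, exists b, (k.+1 < #|J|)%N ->
    alpha`_k < b < alpha`_k.+1 /\ root q b.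
  move=> k; have [lt_k|] := boolP (k.+1 < #|J|)%N; last by exists 0.
  have le_a : alpha`_k <= alpha`_k.+1 by rewrite ltW // lt_alpha // ltnW.
  have [b ab qb] := poly_ivtoo le_a (signs k lt_k).
  by exists b => _; move: ab; rewrite in_itv.
pose beta := mkseq b #|J|.-1.
have szb : size beta = #|J|.-1 by rewrite size_mkseq.
have betaE k : (k.+1 < #|J|)%N -> beta`_k = b k.
  by move=> lt_k; rewrite nth_mkseq // -ltnS prednK.
have ltJ k : (k < size beta)%N -> (k.+1 < #|J|)%N by rewrite szb -[in X in _ -> X](prednK J0).
have sb : sorted <%R beta.
  apply/(sortedP 0) => k lt_k; have lt_k1 := ltJ _ lt_k; have lt_k0 := ltnW lt_k1.
  rewrite !betaE //; have [/andP[_ lt1] _] := bP _ lt_k0.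
  by have [/andP[lt2 _] _] := bP _ lt_k1; apply: lt_trans lt2.
have q_coef : q`_#|J|.-1 != 0.
  rewrite cone_poly_coef gt_eqF //; have /card_gt0P [i Ji] := J0.
  by rewrite (bigD1 i) //= ltr_pwDl ?w_gt0 ?sumr_ge0.
have szq : size q = (size beta).+1.
  rewrite szb prednK //; apply/eqP; rewrite eqn_leq size_cone_poly leqNgt.
  apply: contra q_coef => lt_q; rewrite nth_default //.
  by rewrite -ltnS prednK.
exists alpha, beta; split=> //.
- split; first by rewrite monic_neq0 // node_poly_monic.
    exact: sort_le_sorted.
  by rewrite (monicP (node_poly_monic J)) scale1r node_poly_zeros.
- split; first by rewrite -size_poly_eq0 szq.
    by move: sb; rewrite lt_sorted_uniq_le => /andP[].
  apply: all_roots_prod_XsubC => //; last first.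
    by rewrite uniq_rootsE; move: sb; rewrite lt_sorted_uniq_le => /andP[].
  apply/(all_nthP 0) => k lt_k; rewrite betaE ?ltJ //.
  by have [] := bP k (ltJ _ lt_k).
- by rewrite sza szb prednK.
move=> k lt_k; have lt_k1 := ltJ _ lt_k; rewrite betaE //.
by have [/andP[/ltW ? /ltW ?] _] := bP _ lt_k1.
Qed.

(** A zero x_i of the combination is either a node of weight 0 or a repeated
    node. In both cases X - x_i is a common factor, whose removal leaves a
    combination of the same kind with one node less. *)
Theorem cone_interlaces w J : (forall i, 0 <= w i) ->
  (exists2 i, i \in J & w i != 0) ->
  interlaces (cone_poly w J) (node_poly J).
Proof.
have [k] := ubnP #|J|; elim: k w J => // k IHk w J.
rewrite ltnS => le_k w_ge0 [i0 Ji0 wi0].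
have [/forall_inP simpleJ|] := boolP [forall i in J, (cone_poly w J).[x i] != 0].
  by apply: cone_interlaces_simple => //; apply/card_gt0P; exists i0.
case/forall_inPn => i Ji; rewrite negbK cone_poly_eval // mulf_eq0.
have lt_k : (#|J :\ i| < k)%N by apply: leq_trans le_k; rewrite [in ltnRHS](cardsD1 i J) Ji.
have [wi _|wi /= /eqP] := eqVneq (w i) 0.
  rewrite (cone_polyD1 _ Ji) wi scale0r add0r (node_polyD1 Ji).
  apply: interlacesM; apply: IHk => //; exists i0 => //.
  by rewrite !inE Ji0 andbT; apply: contraNneq wi0 => ->; rewrite wi.
rewrite horner_prod => /eqP/prodf_eq0[j]; rewrite !inE => /andP[ji Jj].
rewrite hornerXsubC subr_eq0 => /eqP xij.
(* the weight of the discarded copy of the node goes to the remaining one *)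
pose w' l := if l == j then w j + w i else w l.
have Jij : j \in J :\ i by rewrite !inE ji.
suff -> : cone_poly w J = ('X - (x i)%:P) * cone_poly w' (J :\ i).
  rewrite (node_polyD1 Ji); apply: interlacesM; apply: IHk => // [l|].
    by rewrite /w'; case: eqP => // _; rewrite addr_ge0.
  exists j => //; rewrite /w' eqxx gt_eqF // ltr_wpDl //.
  by rewrite lt_def wi w_ge0.
rewrite (cone_polyD1 _ Ji) {1}(node_polyD1 Jij) -xij scalerAr -mulrDr; congr (_ * _).
rewrite /cone_poly !(big_setD1 j Jij) /= /w' eqxx addrA scalerDl [_ + w i *: _]addrC.
congr (_ + _); apply: eq_bigr => l; rewrite !inE => /andP[/negPf-> _] //.
Qed.

End Cone.
End Interlacing.

(** * Signs at simple zeros and partial fractions *)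

Section SimpleZeros.
Variable K : fieldType.
Implicit Types (p q : {poly K}) (s : seq K).

Lemma deriv_prod_XsubC_at s z : z \in s ->
  (\prod_(y <- s) ('X - y%:P))^`().[z] = \prod_(y <- rem z s) (z - y).
Proof.
move=> sz; rewrite (perm_big _ (perm_to_rem sz)) /= big_cons derivM derivXsubC.
rewrite mul1r hornerD hornerM hornerXsubC subrr mul0r addr0 horner_prod.
by apply: eq_bigr => y _; rewrite hornerXsubC.
Qed.

(** Compare coefficients of degree size s - 1 in Lagrange's interpolation formula,
    where the denominators are the values of the derivative of the nodal
    polynomial. *)
Lemma partial_fractions_lead q s : uniq s -> (size q <= size s)%N ->
  q`_(size s).-1
    = \sum_(z <- s) q.[z] / (\prod_(y <- s) ('X - y%:P))^`().[z].
Proof.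
move=> us sq; pose N z := \prod_(y <- rem z s) ('X - y%:P).
pose P := \prod_(y <- s) ('X - y%:P).
have szN z : z \in s -> size (N z) = size s.
  by move=> sz; rewrite size_prod_XsubC size_rem // prednK //; case: (s) sz.
have NE z y : z \in s -> y \in s -> (N z).[y] = if y == z then P^`().[z] else 0.
  move=> sz sy; have [->|yz] := eqVneq y z.
    rewrite deriv_prod_XsubC_at // horner_prod.
    by apply: eq_bigr => t _; rewrite hornerXsubC.
  by apply/eqP; rewrite -/(root _ _) root_prod_XsubC mem_rem_uniq // !inE yz.
have P'0 z : z \in s -> P^`().[z] != 0.
  move=> sz; rewrite deriv_prod_XsubC_at // prodf_seq_neq0; apply/allP => y.
  by rewrite mem_rem_uniq // inE subr_eq0 eq_sym => /andP[].
have Dq : q = \sum_(z <- s) (q.[z] / P^`().[z]) *: N z.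
  apply/eqP; rewrite -subr_eq0; apply/negPn/negP => r0.
  set r := q - _ in r0; suff : (size s < size r)%N.
    rewrite ltnNge; case/negP; rewrite (leq_trans (size_polyD _ _)) // geq_max sq.
    rewrite size_polyN; apply: leq_trans (size_sum _ _ _) _.
    apply/bigmax_leqP_seq => z sz _; rewrite (leq_trans (size_scale_leq _ _)) //.
    by rewrite szN.
  apply: max_poly_roots => //; apply/allP => y sy; rewrite rootE /r hornerD hornerN.
  rewrite horner_sum (bigD1_seq y) //= hornerZ NE // eqxx divfK ?P'0 //.
  rewrite big_seq_cond big1 ?addr0 ?subrr // => z /andP[sz zy].
  by rewrite hornerZ NE // eq_sym (negPf zy) mulr0.
rewrite {1}Dq coef_sum; apply: eq_big_seq => z sz; rewrite coefZ.
have /monicP := monic_prod_XsubC (rem z s) xpredT id.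
by rewrite -/(N z) lead_coefE szN // => ->; rewrite mulr1.
Qed.

End SimpleZeros.

Section InterlacingSign.
Variable R : realType.
Implicit Types (p q : {poly R}).

Lemma prod_termwise_ge0 (s t : seq R) z : size s = size t ->
  (forall i, (i < size s)%N -> 0 <= (z - s`_i) * (z - t`_i)) ->
  0 <= (\prod_(y <- s) (z - y)) * \prod_(y <- t) (z - y).
Proof.
elim: s t => [|x s IHs] [|y t] //= => [_ _|[sz] ge0].
  by rewrite !big_nil mulr1.
rewrite !big_cons mulrACA mulr_ge0 //; first exact: (ge0 0%N).
by apply: IHs => // i lt_i; apply: (ge0 i.+1).
Qed.

(** Omitting a zero z of p from its list of zeros leaves a list that lies around z
    in the same way as the zeros of q do: the k-th entries of the two are on
    the same side of z. So q(z) and p'(z) agree in sign up to the signs of the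
    leading coefficients. *)
Lemma interlaces_sign q p : interlaces q p ->
  coprimep p p^`() -> coprimep p q -> exists alpha,
  [/\ uniq alpha, p = lead_coef p *: \prod_(z <- alpha) ('X - z%:P)
    & forall z, z \in alpha ->
        0 < (lead_coef q * lead_coef p) * (q.[z] * p^`().[z])].
Proof.
move=> [alpha [beta [[p0 sa Dp] [q0 sb Dq] sz leab]]] copp' copq.
have rootp z : z \in alpha -> root p z.
  by move=> az; rewrite Dp rootZ ?lead_coef_eq0 // root_prod_XsubC.
have ua : uniq alpha.
  rewrite -separable_prod_XsubC unlock.
  by move: copp'; rewrite Dp derivZ coprimepZl ?coprimepZr ?lead_coef_eq0.
exists alpha; split=> // z az; rewrite lt_def; apply/andP; split.
  rewrite !mulf_neq0 ?lead_coef_eq0 //; first exact: coprimep_root (rootp z az).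
  exact: coprimep_root (rootp z az).
rewrite {2}Dp derivZ hornerZ {2}Dq hornerZ deriv_prod_XsubC_at //.
set lq := lead_coef q; set lp := lead_coef p; rewrite horner_prod.
under eq_bigr do rewrite hornerXsubC.
set B := \prod_(_ <- beta) _; set G := \prod_(_ <- _) _.
have -> : lq * lp * (lq * B * (lp * G)) = (lq * lp) ^+ 2 * (B * G) by ring.
rewrite mulr_ge0 ?sqr_ge0 // /B /G {B G}.
(* the k-th zero of p is z: entries of index below k are at most z, the others
   at least z, both in beta and in alpha without z *)
have [k lt_k Dz] : exists2 k, (k < size alpha)%N & z = alpha`_k.
  by exists (index z alpha); rewrite ?index_mem // nth_index.
have lea i j : (i <= j)%N -> (j < size alpha)%N -> alpha`_i <= alpha`_j.
  by move=> ij lt_j; rewrite le_sorted_leq_nth // ?inE // (leq_ltn_trans ij).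
have -> : rem z alpha = take k alpha ++ drop k.+1 alpha.
  by rewrite remE Dz index_uniq.
have szt : size (take k alpha) = k by rewrite size_take lt_k.
apply: prod_termwise_ge0 => [|i lt_i].
  by rewrite size_cat szt size_drop sz subSS subnKC // -ltnS -sz.
have [le1 le2] := leab i lt_i.
rewrite nth_cat szt; case: ltnP => [lt_ik|le_ki].
  rewrite nth_take // Dz mulr_ge0 // subr_ge0; last by apply: lea; rewrite // ltnW.
  by apply: le_trans le2 (lea _ _ lt_ik lt_k).
rewrite nth_drop addSn subnKC // Dz mulr_le0 // subr_le0.
  by apply: le_trans le1; apply: lea => //; rewrite sz ltnW.
by apply: lea; rewrite ?sz ?ltnS // ltnW // ltnS.
Qed.

End InterlacingSign.

(** * The adjugate of a singular Hermitian matrix *)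

Section HermitianForms.
Variable C : numClosedFieldType.

Lemma hermsymmxP d (A : 'M[C]_d) : reflect (A ^t* = A) (A \is hermsymmx).
Proof.
by rewrite qualifE /= expr0 scale1r; apply: (iffP eqP) => /esym.
Qed.

Definition hform d (B : 'M[C]_d) (x y : 'cV[C]_d) : C :=
  (x^T *m B *m map_mx Num.conj y) ord0 ord0.

Lemma hform_conj d (B : 'M[C]_d) x y : B \is hermsymmx ->
  Num.conj (hform B x y) = hform B y x.
Proof.
move=> /hermsymmxP hB; rewrite /hform.
have -> (A : 'M[C]_1) : Num.conj (A ord0 ord0) = (A ^t*) ord0 ord0 by rewrite !mxE.
rewrite !trmx_mul !map_mxM trmxK mulmxA; congr ((_ *m _ *m _) _ _).
  by apply/matrixP => i j; rewrite !mxE /= conjCK.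
by [].
Qed.

Lemma adj_hermsymmx d (N : 'M[C]_d) : N \is hermsymmx -> \adj N \is hermsymmx.
Proof.
by move=> /hermsymmxP hN; apply/hermsymmxP; rewrite trmx_adj map_mx_adj hN.
Qed.

(** A matrix of rank at most one is a column times a row, and then hform is a
    product of a function of x and a function of y. *)
Lemma hform_rank1 d (B : 'M[C]_d) x y : (\rank B <= 1)%N ->
  hform B x x * hform B y y = hform B x y * hform B y x.
Proof.
rewrite -{2 3 4 5}(mulmx_base B).
move: (\rank B) (col_base B) (row_base B) => r U V r_le1.
have E (u v : 'cV[C]_d) : hform (U *m V) u v
    = \sum_k (u^T *m U) ord0 k * (V *m map_mx Num.conj v) k ord0.
  by rewrite /hform mulmxA -mulmxA mxE.
rewrite !E; case: r r_le1 U V {E} => [|[|//]] _ U V; first by rewrite !big_ord0 mul0r.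
by rewrite !big_ord1 mulrACA [RHS]mulrACA [X in _ = _ * X]mulrC.
Qed.

(** A nonzero adjugate means a nonvanishing minor of order d - 1; since
    N * adj N = 0, the rank of adj N is at most d minus that of N. *)
Lemma mxrank_adj (K : fieldType) d (N : 'M[K]_d) : \det N = 0 -> (\rank (\adj N) <= 1)%N.
Proof.
move=> N0; have [->|adjN0] := eqVneq (\adj N) 0; first by rewrite mxrank0.
have [i [j Nij]] : exists i j, \adj N i j != 0.
  apply: contrapT => Nex; case/eqP: adjN0; apply/matrixP => i j; rewrite [RHS]mxE.
  by apply/eqP/negPn/negP => Nij; apply: Nex; exists i, j.
case: d N N0 adjN0 i j Nij => [|d] N N0 adjN0 i j; first by case: i.
rewrite mxE /cofactor mulf_eq0 negb_or => /andP[_ minor0].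
have rk_minor : \rank (row' j (col' i N)) = d.
  by apply: mxrank_unit; rewrite unitmxE unitfE.
have le_rk : (d <= \rank N)%N.
  rewrite -{1}rk_minor row'Esub (leq_trans (mxrankS (rowsub_sub _ _))) //.
  by rewrite -mxrank_tr -[leqRHS]mxrank_tr tr_col' row'Esub mxrankS ?rowsub_sub.
have /mulmx0_rank_max : N *m \adj N = 0 by rewrite mul_mx_adj N0 raddf0.
by move=> le_sum; rewrite -(leq_add2l d) addn1 (leq_trans _ le_sum) // leq_add2r.
Qed.

(** This turns definiteness of the adjugate into definiteness of E. *)
Lemma hform_adj d (E : 'M[C]_d) v : E \is hermsymmx ->
  hform (\adj E) (map_mx Num.conj (E *m v)) (map_mx Num.conj (E *m v)) =
  \det E * (v ^t* *m E *m v) ord0 ord0.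
Proof.
move=> /hermsymmxP hE; rewrite /hform.
have -> : map_mx Num.conj (map_mx Num.conj (E *m v)) = E *m v.
  by apply/matrixP => i j; rewrite !mxE /= conjCK.
have -> : (map_mx Num.conj (E *m v))^T = v^t* *m E.
  by rewrite map_trmx trmx_mul map_mxM hE.
rewrite -[_ *m \adj E]mulmxA mul_mx_adj mul_mx_scalar -!scalemxAl mxE.
by rewrite mulmxA.
Qed.

End HermitianForms.

(** N stands for the pencil t E + A on one line, whose determinant is p, and q
    for the interlacer given by lam. All that matters about N is that it is
    Hermitian at real points, and the degree and leading coefficients of its
    adjugate. *)
Section InterlacerDefinite.
Variables (R : realType) (d : nat).
Local Notation C := R[i].
Variables (E : 'M[C]_d.+1) (N : 'M[{poly C}]_d.+1).
Variables (p q : {poly R}) (lam : 'cV[C]_d.+1).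

Definition poly_form (x y : 'cV[C]_d.+1) : {poly C} :=
  ((map_mx polyC x)^T *m \adj N *m map_mx (polyC \o Num.conj) y) ord0 ord0.

Hypothesis N_herm : forall z : R, map_mx (horner_eval z%:C) N \is hermsymmx.
Hypothesis detN : \det N = map_poly (real_complex R) p.
Hypothesis lead_p : \det E = (lead_coef p)%:C.
Hypothesis size_adjN : forall i j, (size (\adj N i j) <= d.+1)%N.
Hypothesis lead_adjN : forall i j, (\adj N i j)`_d = \adj E i j.
Hypothesis size_p : size p = d.+2.
Hypothesis qE : poly_form lam lam = map_poly (real_complex R) q.

Lemma poly_formE x y : poly_form x y
  = \sum_i \sum_j (x i ord0 * Num.conj (y j ord0)) *: \adj N i j.
Proof.
rewrite /poly_form mxE exchange_big; apply: eq_bigr => j _.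
rewrite !mxE big_distrl; apply: eq_bigr => i _ /=.
by rewrite !mxE -mulrA mulrC -mulrA -polyCM mulrC mul_polyC [_ * x _ _]mulrC.
Qed.

Lemma hformE (B : 'M[C]_d.+1) x y : hform B x y
  = \sum_i \sum_j (x i ord0 * Num.conj (y j ord0)) * B i j.
Proof.
rewrite /hform mxE exchange_big; apply: eq_bigr => j _.
rewrite !mxE big_distrl; apply: eq_bigr => i _ /=.
by rewrite !mxE mulrAC.
Qed.

Lemma size_poly_form x y : (size (poly_form x y) <= d.+1)%N.
Proof.
rewrite poly_formE (leq_trans (size_sum _ _ _)) //; apply/bigmax_leqP => i _.
rewrite (leq_trans (size_sum _ _ _)) //; apply/bigmax_leqP => j _.
by rewrite (leq_trans (size_scale_leq _ _)).
Qed.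

Lemma lead_poly_form x y : (poly_form x y)`_d = hform (\adj E) x y.
Proof.
rewrite poly_formE hformE coef_sum; apply: eq_bigr => i _.
by rewrite coef_sum; apply: eq_bigr => j _; rewrite coefZ lead_adjN.
Qed.

Lemma horner_poly_form x y z :
  (poly_form x y).[z] = hform (\adj (map_mx (horner_eval z) N)) x y.
Proof.
rewrite poly_formE hformE horner_sum; apply: eq_bigr => i _.
rewrite horner_sum; apply: eq_bigr => j _.
by rewrite hornerZ -map_mx_adj [in RHS]mxE.
Qed.

Section Sign.
Variable alpha : seq R.
Hypothesis uniq_alpha : uniq alpha.
Hypothesis pE : p = lead_coef p *: \prod_(z <- alpha) ('X - z%:P).
Hypothesis sign_alpha : forall z, z \in alpha ->
  0 < (lead_coef q * lead_coef p) * (q.[z] * p^`().[z]).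

(** The leading coefficient of the form of mu is, by partial fractions, a sum
    over the zeros z of p. The numerator of each term becomes a squared
    modulus when multiplied by the value of the interlacer at z, so it has the
    sign of that value or vanishes. If all terms vanish, then adj(N(z)) kills conj(mu) at every
    zero z, which are too many for the degree of the adjugate. *)
Lemma interlacer_adj_definite mu : mu != 0 ->
  0 < (lead_coef q * lead_coef p)%:C * (hform (\adj E) mu mu / \det E).
Proof.
move=> mu0; move: sign_alpha; move: (lead_coef q * _) => k sign_k.
have p0 : p != 0 by rewrite -size_poly_eq0 size_p.
have lp0 : lead_coef p != 0 by rewrite lead_coef_eq0.
have sza : size alpha = d.+1.
  by apply: succn_inj; rewrite -size_p pE size_scale // size_prod_XsubC.
pose B z := \adj (map_mx (horner_eval z%:C) N).
have B_herm z : B z \is hermsymmx by apply: adj_hermsymmx.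
have B_rank z : z \in alpha -> (\rank (B z) <= 1)%N.
  move=> az; apply: mxrank_adj; rewrite det_map_mx detN /= /horner_eval horner_map /=.
  have /eqP -> : root p z by rewrite pE rootZ // root_prod_XsubC.
  by rewrite rmorph0.
pose P := \prod_(z <- alpha) ('X - z%:P).
have deP z : p^`().[z] = lead_coef p * P^`().[z] by rewrite {1}pE derivZ hornerZ.
have Dlead : hform (\adj E) mu mu
    = \sum_(z <- alpha) hform (B z) mu mu / (P^`().[z])%:C.
  pose alphaC := [seq z%:C | z <- alpha].
  have DPC : \prod_(y <- alphaC) ('X - y%:P) = map_poly (real_complex R) P.
    rewrite rmorph_prod big_map; apply: eq_bigr => z _.
    by rewrite rmorphB /= map_polyX map_polyC.
  have := @partial_fractions_lead _ (poly_form mu mu) alphaC.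
  rewrite size_map sza lead_poly_form => -> //; last exact: size_poly_form.
    rewrite big_map; apply: eq_bigr => z _.
    by rewrite horner_poly_form DPC deriv_map horner_map.
  by rewrite map_inj_uniq //; apply: complexI.
have normB z x : z \in alpha ->
    hform (B z) x x * hform (B z) mu mu = `|hform (B z) x mu| ^+ 2.
  by move=> az; rewrite hform_rank1 ?B_rank // normCK hform_conj.
(* k b / p' = (k^2 / (k q p')) (q b), where q b is a squared modulus *)
have termE z : z \in alpha -> k%:C * (hform (B z) mu mu / (p^`().[z])%:C)
    = (k ^+ 2 / (k * (q.[z] * p^`().[z])))%:C * `|hform (B z) lam mu| ^+ 2.
  move=> az; rewrite -normB // -(horner_poly_form lam lam) qE horner_map /=.
  have /lt0r_neq0 := sign_k z az; rewrite !mulf_eq0 !negb_or.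
  case/and3P=> k0 q0 p'0; rewrite [RHS]mulrA -rmorphM /= -fmorphV mulrCA.
  rewrite -rmorphM mulrC; congr (_%:C * _); by field; rewrite k0 q0 p'0.
have term_ge0 z : z \in alpha ->
    0 <= k%:C * (hform (B z) mu mu / (p^`().[z])%:C).
  move=> az; rewrite termE // mulr_ge0 ?exprn_ge0 // ler0c.
  by rewrite divr_ge0 ?sqr_ge0 // ltW // sign_k.
have term_eq0 z : z \in alpha ->
    k%:C * (hform (B z) mu mu / (p^`().[z])%:C) = 0 -> B z *m map_mx Num.conj mu = 0.
  move=> az /eqP; have /lt0r_neq0 := sign_k z az.
  rewrite !mulf_eq0 !negb_or invr_eq0 !fmorph_eq0 => /and3P[/negPf-> _ /negPf->] /=.
  rewrite orbF => /eqP b0; apply/matrixP => i j; rewrite ord1 [RHS]mxE.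
  have /eqP := normB z (delta_mx i ord0) az.
  rewrite b0 mulr0 eq_sym expf_eq0 /= normr_eq0 => /eqP.
  by rewrite /hform trmx_delta -mulmxA -rowE mxE.
have -> : k%:C * (hform (\adj E) mu mu / \det E)
    = \sum_(z <- alpha) k%:C * (hform (B z) mu mu / (p^`().[z])%:C).
  rewrite Dlead big_distrl big_distrr /=; apply: eq_bigr => z _.
  by rewrite lead_p deP rmorphM /= invfM; congr (_ * _); rewrite mulrAC mulrA.
rewrite lt_def big_seq sumr_ge0 // andbT.
rewrite psumr_neq0 //; apply: contraNT mu0 => /hasPn term0.
have B0 z : z \in alpha -> B z *m map_mx Num.conj mu = 0.
  move=> az; apply: term_eq0 => //; apply/eqP.
  by have := term0 z az; rewrite az /= lt_def term_ge0 // andbT negbK.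
have adjN0 : \adj N *m map_mx (polyC \o Num.conj) mu = 0.
  apply/matrixP => i j; rewrite ord1 [RHS]mxE.
  apply: (@roots_geq_poly_eq0 _ _ [seq z%:C | z <- alpha]).
  - apply/allP => _ /mapP [z az ->]; rewrite rootE -/(horner_eval _ _).
    have := congr1 (fun X : 'M_(_, 1) => X i ord0) (B0 z az).
    rewrite /B -map_mx_adj [in LHS]mxE [RHS]mxE => <-.
    rewrite mxE rmorph_sum; apply/eqP/eq_bigr => l _.
    by rewrite !mxE rmorphM /= /horner_eval hornerC.
  - by rewrite map_inj_uniq //; apply: complexI.
  rewrite size_map sza mxE (leq_trans (size_sum _ _ _)) //; apply/bigmax_leqP => l _.
  by rewrite [X in _ * X]mxE mulrC mul_polyC (leq_trans (size_scale_leq _ _)).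
have : map_mx (polyC \o Num.conj) mu = 0.
  apply/matrixP => i j; have := congr1 (fun X => (N *m X) i j) adjN0.
  rewrite /= mulmxA mul_mx_adj mul_scalar_mx mulmx0 mxE [RHS]mxE => /eqP.
  by rewrite mulf_eq0 detN map_poly_eq0 (negPf p0) /= [in RHS]mxE => /eqP.
move/matrixP => mu0; apply/eqP/matrixP => i j; have /eqP := mu0 i j.
by rewrite !mxE /= polyC_eq0 conjC_eq0 => /eqP.
Qed.

End Sign.
End InterlacerDefinite.

(** * Definite pencils *)

Section SimultaneousDiagonalization.
Variable C : numClosedFieldType.

Lemma trCM m n r (A : 'M[C]_(m, n)) (B : 'M[C]_(n, r)) :
  (A *m B) ^t* = B ^t* *m A ^t*.
Proof. by rewrite trmx_mul map_mxM. Qed.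

(** Diagonalize E unitarily and rescale by the inverse square roots of its
    eigenvalues. *)
Lemma posdef_congr1 d (E : 'M[C]_d) : E \is hermsymmx ->
  (forall v : 'cV[C]_d, v != 0 -> 0 < (v ^t* *m E *m v) ord0 ord0) ->
  exists S : 'M[C]_d, S ^t* *m E *m S = 1%:M.
Proof.
move=> hE E_gt0; set P := spectralmx E; set D := spectral_diag E.
have PU : P \is unitarymx := spectral_unitarymx E.
have PP : P *m P ^t* = 1%:M := elimT unitarymxP PU.
have DE : E = P ^t* *m diag_mx D *m P.
  by rewrite -invmx_unitary //; apply/orthomx_spectralP/hermitian_normalmx.
have D_gt0 i : 0 < D ord0 i.
  pose v : 'cV[C]_d := P ^t* *m delta_mx i ord0.
  have v0 : v != 0.
    apply: contraNneq (oner_neq0 C) => v0.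
    have := congr1 (fun X => (P *m X) i ord0) v0.
    by rewrite /v mulmxA PP mul1mx mulmx0 !mxE !eqxx => /eqP.
  have := E_gt0 v v0; rewrite /v trCM trmxCK DE !mulmxA -[_ *m P *m P ^t*]mulmxA PP.
  rewrite mulmx1 -[_ *m P *m P ^t*]mulmxA PP mulmx1 trmx_delta.
  have -> : map_mx Num.conj (delta_mx ord0 i) = delta_mx ord0 i :> 'rV[C]_d.
    by apply/matrixP => k l; rewrite !mxE conjC_nat.
  by rewrite -colE -rowE !mxE eqxx mulr1n.
pose s : 'rV[C]_d := \row_i (sqrtC (D ord0 i))^-1.
exists (P ^t* *m diag_mx s); rewrite trCM trmxCK DE.
have -> : (diag_mx s) ^t* = diag_mx s.
  rewrite tr_diag_mx map_diag_mx; congr diag_mx; apply/rowP => i; rewrite !mxE.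
  by apply/CrealP; rewrite rpredV ger0_real // sqrtC_ge0 ltW.
rewrite !mulmxA -[_ *m P *m P ^t*]mulmxA PP mulmx1 -[_ *m P *m P ^t*]mulmxA PP mulmx1.
rewrite !mulmx_diag -diag_const_mx; congr diag_mx; apply/rowP => i; rewrite !mxE.
have sD0 : sqrtC (D ord0 i) != 0 by rewrite sqrtC_eq0 gt_eqF.
by rewrite -{2}[D ord0 i]sqrtCK expr2 mulrA mulVf // mul1r divff.
Qed.

(** After the congruence that makes E the identity, a unitary change of basis
    diagonalizes A without affecting E. *)
Lemma simultaneous_diag d (E A : 'M[C]_d) : E \is hermsymmx -> A \is hermsymmx ->
  (forall v : 'cV[C]_d, v != 0 -> 0 < (v ^t* *m E *m v) ord0 ord0) ->
  exists (T : 'M[C]_d) (L : 'rV[C]_d),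
    [/\ T ^t* *m E *m T = 1%:M, T ^t* *m A *m T = diag_mx L & L \is a realmx].
Proof.
move=> hE /hermsymmxP hA E_gt0; have [S SE] := posdef_congr1 hE E_gt0.
pose B := S ^t* *m A *m S.
have hB : B \is hermsymmx.
  by apply/hermsymmxP; rewrite /B !trCM trmxCK hA mulmxA.
set Q := spectralmx B; have QU : Q \is unitarymx := spectral_unitarymx B.
have QQ : Q *m Q ^t* = 1%:M := elimT unitarymxP QU.
have DB : B = Q ^t* *m diag_mx (spectral_diag B) *m Q.
  by rewrite -invmx_unitary //; apply/orthomx_spectralP/hermitian_normalmx.
exists (S *m Q ^t*), (spectral_diag B); rewrite trCM trmxCK; split.
- by rewrite !mulmxA -[Q *m _ *m E]mulmxA -[Q *m _ *m S]mulmxA SE mulmx1.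
- rewrite !mulmxA -[Q *m _ *m A]mulmxA -[Q *m _ *m S]mulmxA -/B {1}DB.
  by rewrite !mulmxA QQ mul1mx -mulmxA QQ mulmx1.
exact: hermitian_spectral_diag_real.
Qed.

End SimultaneousDiagonalization.

Section DefinitePencil.
Variables (R : realType) (d : nat).
Local Notation C := R[i].
Local Notation toC := (map_poly (real_complex R)).
Implicit Types (E A : 'M[C]_d.+1) (lam : 'cV[C]_d.+1).

Definition pencil2 E A : 'M[{poly C}]_d.+1 := 'X *: map_mx polyC E + map_mx polyC A.

(** In the basis given by T the pencil is diagonal with entries t - x_i, and its
    adjugate has the complementary products on the diagonal; the weights are
    the squared moduli of the coordinates of lam. *)
Lemma posdef_pencil_cone E A lam : posdefmx E -> A \is hermsymmx -> lam != 0 ->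
  exists (c : R) (x w : 'I_d.+1 -> R),
  [/\ c != 0, forall i, 0 <= w i, exists i, w i != 0,
      \det (pencil2 E A) = c%:C *: toC (node_poly x setT)
    & poly_form (pencil2 E A) lam lam = c%:C *: toC (cone_poly x w setT)].
Proof.
move=> [hE E_gt0] hA lam0; have [T [L [TE TA Lreal]]] := simultaneous_diag hE hA E_gt0.
set N := pencil2 E A.
pose x i : R := - complex.Re (L ord0 i).
have LE i : L ord0 i = - (x i)%:C.
  by rewrite /x rmorphN opprK; apply/esym/RRe_real/(mxOverP Lreal).
pose Tp := map_mx polyC T; pose Tq := map_mx polyC (T ^t*).
pose D : 'rV[{poly C}]_d.+1 := \row_i toC ('X - (x i)%:P).
pose D' : 'rV[{poly C}]_d.+1 := \row_i toC (node_poly x (setT :\ i)).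
have Tunit : T \in unitmx by have [_ ?] := mulmx1_unit TE.
have detT0 : \det T != 0 by rewrite -unitfE -unitmxE.
have TNT : Tq *m N *m Tp = diag_mx D.
  rewrite /N /pencil2 mulmxDr mulmxDl -scalemxAr -scalemxAl -!map_mxM TE TA.
  apply/matrixP => i j; rewrite !mxE LE rmorphB /= map_polyX map_polyC /=.
  case: (i == j); rewrite ?mulr1n ?mulr0n ?polyC0 ?mulr0 ?addr0 // mulr1.
  by rewrite polyCN.
have DD' : diag_mx D *m diag_mx D' = (toC (node_poly x setT))%:M.
  rewrite mulmx_diag -diag_const_mx; congr diag_mx; apply/rowP => i.
  by rewrite !mxE -rmorphM -node_polyD1 ?inE.
pose delta : R := complex.Re (\det (T ^t*) * \det T).
have deltaE : \det (T ^t*) * \det T = delta%:C.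
  apply/esym/RRe_real; rewrite det_map_mx det_tr mulrC -normCK.
  by rewrite ger0_real // exprn_ge0.
have delta0 : delta != 0.
  rewrite -(inj_eq (@complexI R)) -deltaE mulf_neq0 // det_map_mx det_tr.
  by rewrite conjC_eq0.
have detD : \det (diag_mx D) = toC (node_poly x setT).
  rewrite det_diag /node_poly rmorph_prod; apply: eq_big => [i|i _]; first by rewrite inE.
  by rewrite mxE.
have detN : delta%:C *: \det N = toC (node_poly x setT).
  rewrite -detD -TNT !det_mulmx (det_map_mx _ (T ^t*)) (det_map_mx _ T) mulrAC -rmorphM /= deltaE.
  by rewrite mul_polyC.
have detN0 : \det N != 0.
  apply: contraTneq (monic_neq0 (node_poly_monic x setT)) => N0.
  by rewrite -(map_poly_eq0 (real_complex R)) -detN N0 scaler0 eqxx.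
(* both sides become equal after multiplication by N, whose determinant is
   not zero *)
have adjN : (delta%:C)%:P *: \adj N = Tp *m diag_mx D' *m Tq.
  have Tq_unit : Tq \in unitmx.
    by rewrite map_unitmx map_unitmx unitmx_tr.
  have NT : N *m (Tp *m diag_mx D' *m Tq) = ((delta%:C)%:P * \det N)%:M.
    apply: (can_inj (mulKmx Tq_unit)); rewrite !mulmxA TNT DD' -detN mul_polyC.
    by rewrite mul_scalar_mx mul_mx_scalar.
  apply/matrixP => i j; apply: (mulfI detN0).
  have := congr1 (fun X => (\adj N *m X) i j) NT.
  rewrite /= mulmxA mul_adj_mx mul_scalar_mx mul_mx_scalar [in LHS]mxE => ->.
  by rewrite [in LHS]mxE [in RHS]mxE mulrCA mulrA.
pose u := lam^T *m T.
have u0 : u != 0.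
  apply: contraNneq lam0 => u0; rewrite -[lam]trmxK -(mulmxK Tunit lam^T) -/u u0.
  by rewrite mul0mx trmx0.
pose w i : R := complex.Re (`|u ord0 i| ^+ 2).
have wE i : (w i)%:C = `|u ord0 i| ^+ 2.
  by apply: RRe_real; rewrite ger0_real // exprn_ge0.
exists delta^-1, x, w; split=> [|i|||].
- by rewrite invr_eq0.
- by rewrite -ler0c wE exprn_ge0.
- apply: contrapT => Nex; case/eqP: u0; apply/rowP => i; rewrite [RHS]mxE.
  apply/eqP; rewrite -normr_eq0 -sqrf_eq0 -wE fmorph_eq0.
  by apply/negPn/negP => wi; apply: Nex; exists i.
- by rewrite -detN scalerA -rmorphM mulVf // scale1r.
have toC_poly_form : (delta%:C)%:P * poly_form N lam lam = toC (cone_poly x w setT).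
  rewrite /poly_form; set lamT := (map_mx polyC lam)^T; set lamc := map_mx _ lam.
  have -> : (delta%:C)%:P * (lamT *m \adj N *m lamc) ord0 ord0
      = (lamT *m ((delta%:C)%:P *: \adj N) *m lamc) ord0 ord0.
    by rewrite -scalemxAr -scalemxAl [RHS]mxE.
  rewrite adjN !mulmxA -[_ *m Tq *m _]mulmxA.
  have -> : lamT *m Tp = map_mx polyC u by rewrite /lamT map_trmx -map_mxM.
  have -> : Tq *m lamc = map_mx (polyC \o Num.conj) u^T.
    have -> : lamc = map_mx polyC (map_mx Num.conj lam).
      by apply/matrixP => i j; rewrite !mxE.
    rewrite -map_mxM -map_mxM /u trmx_mul trmxK.
    by apply/matrixP => i j; rewrite !mxE.
  rewrite /cone_poly rmorph_sum mxE; apply: eq_big => [i|i _]; first by rewrite inE.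
  rewrite mul_mx_diag !mxE /= linearZ /= wE normCK -mul_polyC polyCM mulrAC.
  by rewrite /u !mxE.
rewrite -toC_poly_form mul_polyC scalerA -rmorphM mulVf // scale1r //.
Qed.

(** A negative definite pencil is the opposite of a positive definite one, which
    changes the determinant and the adjugate by signs. *)
Lemma definite_pencil_cone E A lam : definitemx E -> A \is hermsymmx -> lam != 0 ->
  exists (c c' : R) (x w : 'I_d.+1 -> R),
  [/\ c != 0 /\ c' != 0, forall i, 0 <= w i, exists i, w i != 0,
      \det (pencil2 E A) = c%:C *: toC (node_poly x setT)
    & poly_form (pencil2 E A) lam lam = c'%:C *: toC (cone_poly x w setT)].
Proof.
move=> [pE|pE] hA lam0.
  have [c [x [w [c0 w_ge0 w0 detN formN]]]] := posdef_pencil_cone pE hA lam0.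
  by exists c, c, x, w.
have hNA : - A \is hermsymmx.
  by apply/hermsymmxP; rewrite linearN raddfN /= (hermsymmxP _ hA).
have [c [x [w [c0 w_ge0 w0 detN formN]]]] := posdef_pencil_cone pE hNA lam0.
have NE : pencil2 (- E) (- A) = (-1) *: pencil2 E A.
  by apply/matrixP => i j; rewrite !mxE !polyCN mulN1r opprD mulrN.
have signK k (P : {poly C}) : ((-1) ^+ k)%:C *: ((-1) ^+ k * P) = P.
  rewrite -(signr_odd R) -(signr_odd {poly C}); case: (odd k).
    by rewrite !expr1 rmorphN1 scaleN1r mulN1r opprK.
  by rewrite !expr0 scale1r mul1r.
exists ((-1) ^+ d.+1 * c), ((-1) ^+ d * c), x, w; split=> //.
- by rewrite !mulf_neq0 ?expf_neq0 ?oppr_eq0 ?oner_eq0.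
- by rewrite rmorphM -scalerA -detN NE detZ signK.
rewrite rmorphM -scalerA -formN /poly_form NE adjZ -scalemxAr -scalemxAl [in RHS]mxE.
by rewrite signK.
Qed.

End DefinitePencil.

(** * Determinantal representations *)

Lemma rmorph_bilinear (K L : comNzRingType) (u : {rmorphism K -> L}) k
    (x y : 'cV[K]_k) (B : 'M[K]_k) :
  u ((x^T *m B *m y) ord0 ord0)
  = ((map_mx u y)^T *m (map_mx u B)^T *m map_mx u x) ord0 ord0.
Proof.
have -> (X : 'M[K]_1) : u (X ord0 ord0) = ((map_mx u X)^T) ord0 ord0 by rewrite !mxE.
by rewrite !map_mxM !trmx_mul [(map_mx u x^T)^T]map_trmx trmxK mulmxA.
Qed.

Section PencilGeometry.
Variables (R : realType) (m d : nat) (M : 'I_m -> 'M[R[i]]_d.+1).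
Local Notation C := R[i].
Local Notation toC := (real_complex R).
Implicit Types (e a : 'I_m -> R) (f g : {mpoly R[m]}).

Lemma dhomog_det (K : comNzRingType) k (A : 'M[{mpoly K[m]}]_k) :
  (forall i j, A i j \is 1.-homog) -> \det A \is k.-homog.
Proof.
move=> A1; apply: rpred_sum => s _; rewrite rpredMsign.
have prod1 l (F : 'I_l -> {mpoly K[m]}) : (forall i, F i \is 1.-homog) ->
    \prod_i F i \is l.-homog.
  elim: l F => [|l IHl] F F1; first by rewrite big_ord0 dhomog1.
  by rewrite big_ord_recl; apply: (dhomogM (F1 ord0) (IHl _ _)) => i; apply: F1.
exact: prod1.
Qed.

Lemma pencil_entry i j : pencil M i j = \sum_k 'X_k * (M k i j)%:MP.
Proof. by rewrite /pencil summxE; apply: eq_bigr => k _; rewrite !mxE. Qed.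

Lemma dhomog_adj_pencil i j : \adj (pencil M) i j \is d.-homog.
Proof.
rewrite mxE /cofactor rpredMsign; apply: dhomog_det => k l.
rewrite !mxE -/(pencil M) pencil_entry; apply: rpred_sum => r _.
by rewrite mulrC mul_mpolyC rpredZ // dhomogX /= mdeg1.
Qed.

Lemma map_pencil_line e a :
  map_mx (mmap polyC (fun i => (e i)%:C *: 'X + (a i)%:C%:P)) (pencil M)
  = pencil2 (pencil_at M e) (pencil_at M a).
Proof.
apply/matrixP => i j; rewrite !mxE -/(pencil M) pencil_entry rmorph_sum /=.
rewrite /pencil_at !summxE !rmorph_sum mulr_sumr -big_split; apply: eq_bigr => k _ /=.
rewrite rmorphM /= mmapX mmap1U mmapC !mxE mulrDl !polyCM.
by rewrite -mul_polyC mulrAC mulrC mulrA.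
Qed.

Lemma map_pencil_eval e :
  map_mx (meval (fun i => (e i)%:C)) (pencil M) = pencil_at M e.
Proof.
apply/matrixP => i j; rewrite !mxE -/(pencil M) pencil_entry rmorph_sum /=.
rewrite /pencil_at summxE; apply: eq_bigr => k _ /=.
by rewrite rmorphM /= mevalXU mevalC !mxE.
Qed.

Lemma line_adj_form lam e a :
  line_poly (adj_form M lam) (fun i => (e i)%:C) (fun i => (a i)%:C)
  = poly_form (pencil2 (pencil_at M e) (pencil_at M a)) lam lam.
Proof.
rewrite /line_poly /poly_form /adj_form -map_pencil_line.
set L := mmap _ _.
have -> : map_mx polyC lam = map_mx L (map_mx (@mpolyC m C) lam).
  by apply/matrixP => i j; rewrite !mxE /L mmapC.
have -> : map_mx (polyC \o Num.conj) lam
    = map_mx L (map_mx (@mpolyC m C) (map_mx Num.conj lam)).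
  by apply/matrixP => i j; rewrite !mxE /L mmapC.
by rewrite -map_mx_adj [(map_mx L _)^T]map_trmx -!map_mxM [in RHS]mxE.
Qed.

Hypothesis M_herm : forall i, M i \is hermsymmx.

Lemma pencil_at_herm e : pencil_at M e \is hermsymmx.
Proof.
apply/hermsymmxP/matrixP => i j; rewrite !mxE /pencil_at !summxE rmorph_sum.
apply: eq_bigr => k _ /=; rewrite !mxE rmorphM /=.
have /hermsymmxP/matrixP/(_ i j) := M_herm k; rewrite !mxE => ->.
by congr (_ * _); apply/CrealP; apply/complex_realP; exists (e k).
Qed.

Lemma pencil2_at_herm e a (z : R) :
  map_mx (horner_eval z%:C) (pencil2 (pencil_at M e) (pencil_at M a)) \is hermsymmx.
Proof.
have -> : map_mx (horner_eval z%:C) (pencil2 (pencil_at M e) (pencil_at M a))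
    = pencil_at M (fun i => e i * z + a i).
  apply/matrixP => i j; rewrite !mxE /horner_eval hornerD hornerM hornerX !hornerC.
  rewrite /pencil_at !summxE mulr_sumr -big_split; apply: eq_bigr => k _ /=.
  by rewrite !mxE rmorphD rmorphM /= mulrDl mulrCA mulrA.
exact: pencil_at_herm.
Qed.

(** Conjugating the coefficients transposes the Hermitian pencil, and the
    transpose of a 1 x 1 matrix is itself. *)
Lemma adj_form_real lam : exists g, map_mpoly toC g = adj_form M lam.
Proof.
set h := adj_form M lam.
have conj_h : map_mpoly Num.conj h = h.
  have phiP : map_mx (map_mpoly Num.conj) (pencil M) = (pencil M)^T.
    apply/matrixP => i j; rewrite !mxE !pencil_entry rmorph_sum; apply: eq_bigr => k _.
    rewrite rmorphM /= map_mpolyX map_mpolyC /=.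
    have /hermsymmxP/matrixP/(_ j i) := M_herm k; by rewrite !mxE => ->.
  have phi_lam : map_mx (map_mpoly Num.conj) (map_mx (@mpolyC m C) lam)
      = map_mx (@mpolyC m C) (map_mx Num.conj lam).
    by apply/matrixP => i j; rewrite !mxE map_mpolyC.
  have phi_conj : map_mx (map_mpoly Num.conj) (map_mx (@mpolyC m C) (map_mx Num.conj lam))
      = map_mx (@mpolyC m C) lam.
    by apply/matrixP => i j; rewrite !mxE map_mpolyC /= conjCK.
  rewrite /h /adj_form (rmorph_bilinear (map_mpoly Num.conj)) phi_lam phi_conj.
  by rewrite map_mx_adj phiP -trmx_adj trmxK.
exists (\sum_(mn <- msupp h) complex.Re h@_mn *: 'X_[mn]).
rewrite rmorph_sum [RHS]mpolyE; apply: eq_bigr => mn _ /=.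
rewrite map_mpolyZ map_mpolyX; congr (_ *: _); apply/RRe_real/CrealP.
by rewrite -[in RHS]conj_h mcoeff_map_mpoly.
Qed.

Lemma dhomog_real g k : map_mpoly toC g \is k.-homog -> g \is k.-homog.
Proof.
move=> /dhomogP hg; apply/dhomogP => mn; rewrite mcoeff_msupp => gmn.
by apply: hg; rewrite mcoeff_msupp mcoeff_map_mpoly fmorph_eq0.
Qed.

Lemma dhomog_adj_form lam : adj_form M lam \is d.-homog.
Proof.
rewrite /adj_form mxE; apply: rpred_sum => j _; rewrite mulrC !mxE mul_mpolyC rpredZ //.
apply: rpred_sum => i _; rewrite !mxE mul_mpolyC -/(cofactor _ _ _).
by rewrite rpredZ //; have := dhomog_adj_pencil i j; rewrite mxE.
Qed.

Variable f : {mpoly R[m]}.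
Hypothesis f_det : map_mpoly toC f = \det (pencil M).
Hypothesis f_homog : f \is d.+1.-homog.

Lemma map_line_det e a : \det (pencil2 (pencil_at M e) (pencil_at M a))
  = map_poly toC (line_poly f e a).
Proof. by rewrite map_line_poly f_det -map_pencil_line det_map_mx. Qed.

Lemma det_pencil_at e : \det (pencil_at M e) = (f.@[e])%:C.
Proof.
rewrite -map_pencil_eval det_map_mx -f_det /= /meval mmap_map_mpoly rmorph_mmap.
exact: eq_mmap.
Qed.

Lemma map_line_adj_form g lam e a : map_mpoly toC g = adj_form M lam ->
  map_poly toC (line_poly g e a)
  = poly_form (pencil2 (pencil_at M e) (pencil_at M a)) lam lam.
Proof. by move=> Dg; rewrite map_line_poly Dg -line_adj_form. Qed.

Lemma definite_interlaces e lam : f != 0 -> definitemx (pencil_at M e) -> lam != 0 ->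
  cx_interlaces_wrt e (adj_form M lam) f.
Proof.
move=> f0 defE lam0; have [g Dg] := adj_form_real lam; exists g; split=> //.
have szf : msize f = d.+2.
  by rewrite -(mlead_deg f0) (dhomogP _ _ _ f_homog _ (mlead_supp f0)).
split=> [|a].
  by rewrite szf; apply: dhomog_real; rewrite Dg dhomog_adj_form.
have [c [c' [x [w [[c0 c'0] w_ge0 [i wi] Df Dh]]]]] :=
  definite_pencil_cone defE (pencil_at_herm a) lam0.
move: Df Dh; rewrite map_line_det -(map_line_adj_form _ _ Dg) -!map_polyZ /=.
move=> /(map_poly_inj (real_complex R)) -> /(map_poly_inj (real_complex R)) ->.
by apply: interlacesZ => //; apply: cone_interlaces => //; exists i; rewrite ?inE.
Qed.

End PencilGeometry.

Lemma const_mx1_neq0 (K : nzRingType) d : const_mx 1 != 0 :> 'cV[K]_d.+1.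
Proof. by apply/eqP => /matrixP/(_ ord0 ord0)/eqP; rewrite !mxE oner_eq0. Qed.

(** On the line given by [generic_line] the interlacer decides the sign of the
    form of adj(M(e)), and [hform_adj] carries it over to M(e). *)
Lemma interlaces_definite (R : realType) n d (f : {mpoly R[n.+1]}) (e : 'I_n.+1 -> R)
    (M : 'I_n.+1 -> 'M[R[i]]_d.+1) lam :
  f \is d.+1.-homog -> irreducible_elt f -> f.@[e] != 0 ->
  (forall i, M i \is hermsymmx) -> map_mpoly (real_complex R) f = \det (pencil M) ->
  cx_interlaces_wrt e (adj_form M lam) f -> definitemx (pencil_at M e).
Proof.
move=> f_homog f_irr fe M_herm f_det [g [Dg [_ gf]]].
have g_homog : g \is d.-homog.
  by apply: dhomog_real; rewrite Dg dhomog_adj_form.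
have g0 : g != 0.
  have [alpha [beta [_ [lg0 _ _] _ _]]] := gf (fun=> 0).
  by apply: contraNneq lg0 => ->; rewrite /line_poly mmap0.
have [a [cop1 cop2]] := generic_line f_irr f_homog fe g0 g_homog.
have [alpha [ua Dp signs]] := interlaces_sign (gf a) cop1 cop2.
set p := line_poly f e a in cop1 cop2 Dp signs.
have [szp lead_p] := dhomog_line_poly e a f_homog.
have szpE : size p = d.+2.
  apply/eqP; rewrite eqn_leq szp ltnNge; apply/negP => sp.
  by case/negP: fe; rewrite -lead_p nth_default.
have lp : lead_coef p = f.@[e] by rewrite lead_coefE szpE.
set E := pencil_at M e; have E_herm : E \is hermsymmx := pencil_at_herm M_herm e.
have detE : \det E = (lead_coef p)%:C by rewrite lp (det_pencil_at f_det).
set N := pencil2 E (pencil_at M a).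
have adjN i j : (size (\adj N i j) <= d.+1)%N /\ (\adj N i j)`_d = \adj E i j.
  have [sz lead] := dhomog_line_poly (fun i => (e i)%:C) (fun i => (a i)%:C)
    (dhomog_adj_pencil M i j).
  rewrite /E -map_pencil_eval /N -map_pencil_line -!map_mx_adj.
  by rewrite [in X in size X]mxE [map_mx _ _ _ _]mxE [map_mx _ _ _ _]mxE.
have pos := interlacer_adj_definite (pencil2_at_herm M_herm e a)
  (map_line_det f_det e a) detE (fun i j => (adjN i j).1) (fun i j => (adjN i j).2)
  szpE (esym (map_line_adj_form e a Dg)) ua Dp signs.
have detE0 : \det E != 0 by rewrite detE fmorph_eq0 lp.
set k := lead_coef _ * _ in pos.
have posE (v : 'cV[R[i]]_d.+1) : v != 0 -> 0 < k%:C * (v ^t* *m E *m v) ord0 ord0.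
  move=> v0; have := pos (map_mx Num.conj (E *m v)); rewrite hform_adj //.
  rewrite mulrAC divff // mul1r; apply.
  apply: contraNneq v0 => Ev0.
  have Eu : E \in unitmx by rewrite unitmxE unitfE.
  rewrite -(mulKmx Eu v) (_ : E *m v = 0) ?mulmx0 //.
  apply/matrixP => i j; have /matrixP/(_ i j)/eqP := Ev0.
  by rewrite [X in X == _]mxE [X in _ == X]mxE conjC_eq0 => /eqP ->; rewrite [RHS]mxE.
have negE : - E \is hermsymmx.
  by apply/hermsymmxP; rewrite linearN raddfN /= (hermsymmxP _ E_herm).
have [k_lt0|k_gt0|k0] := ltgtP k 0.
- right; split=> // v /posE.
  rewrite mulmxN mulNmx [X in _ -> 0 < X]mxE oppr_gt0 nmulr_rgt0 //.
  by rewrite -[0]/(0%:C) ltcR.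
- by left; split=> // v /posE; rewrite pmulr_rgt0 // -[0]/(0%:C) ltcR.
by have := posE _ (const_mx1_neq0 _ d); rewrite k0 mul0r ltxx.
Qed.

Theorem theorem3p3 (R : realType) (n d : nat) (hd : (1 <= d)%N)
    (f : {mpoly R[n.+1]}) (e : 'I_n.+1 -> R)
    (f_homog : f \is d.-homog)
    (f_irr : irreducible_mpoly f)
    (f_hyp : hyperbolic f e)
    (M : 'I_n.+1 -> 'M[R[i]]_d)
    (M_herm : forall i, M i \is hermsymmx)
    (f_det : map_mpoly (real_complex R) f = \det (pencil M)) :
  ((exists h, adj_system M h /\ cx_interlaces_wrt e h f) <->
   (forall h, adj_system M h -> cx_interlaces_wrt e h f))
  /\
  ((forall h, adj_system M h -> cx_interlaces_wrt e h f) <->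
   definitemx (pencil_at M e)).
Proof.
case: d hd f_homog M M_herm f_det => // d _ f_homog M M_herm f_det.
have [f0 _ _] := f_irr; have [fe _] := f_hyp.
have some_def : (exists h, adj_system M h /\ cx_interlaces_wrt e h f) ->
    definitemx (pencil_at M e).
  move=> [_ [[lam [_ ->]]]]; exact: interlaces_definite.
have def_every : definitemx (pencil_at M e) ->
    forall h, adj_system M h -> cx_interlaces_wrt e h f.
  by move=> defE _ [lam [lam0 ->]]; apply: definite_interlaces.
have every_some : (forall h, adj_system M h -> cx_interlaces_wrt e h f) ->
    exists h, adj_system M h /\ cx_interlaces_wrt e h f.
  move=> every; have sys1 : adj_system M (adj_form M (const_mx 1)).
    by exists (const_mx 1); split=> //; apply: const_mx1_neq0.
  by exists (adj_form M (const_mx 1)); split=> //; apply: every.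
split; split=> //.
- by move=> /some_def/def_every.
- by move=> /every_some/some_def.
Qed.
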